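(* Let $d\ge2$ be fixed. There exist constants $C,C',c>0$ (independent of $n,p,q$) such that for all $n\ge2$ and $p,q\in(0,1)$ with $$p^2q^2\ \ge\ C\,\frac{\log n}{n},$$ if the data are drawn from the random corruption model with ground truth $X^\star\in\mathrm{SO}(d)^n$, true-observation ratio $p$ and observation ratio $q$, then with probability at least $1-C'/n$ the following holds: for every $X\in\mathrm{SO}(d)^n$ satisfying $\operatorname{dist}_\infty(X,X^\star)\le c\,p$, $$f(X)-f(X^\star)\ \ge\ \frac{npq}{8}\,\operatorname{dist}_1(X,X^\star).$$
   Context: Notation. $\mathrm{SO}(d)=\{R\in\mathbb{R}^{d\times d}: R^\top R=I,\det R=1\}$. A matrix $X\in\mathbb{R}^{nd\times d}$ is written in $d\times d$ blocks $X=(X_1;\dots;X_n)$; $X\in\mathrm{SO}(d)^n$ means every $X_i\in\mathrm{SO}(d)$. Random corruption model (RCM). Fix $X^\star=(X_1^\star;\dots;X_n^\star)\in\mathrm{SO}(d)^n$. Independently for each pair $i<j$: with probability $pq$, $Y_{ij}=X_i^\star X_j^{\star\top}$ (a true observation, $(i,j)\in\mathcal{A}$); with probability $(1-p)q$, $Y_{ij}=O_{ij}$ with $O_{ij}$ uniformly (Haar) distributed on $\mathrm{SO}(d)$, independent of everything else (an outlier, $(i,j)\in\mathcal{A}^c$); with probability $1-q$, $Y_{ij}=0$ (missing). Set $Y_{ji}=Y_{ij}^\top$ and $Y_{ii}=0$; membership of pairs is symmetric in $(i,j)$, and $\mathcal{E}=\mathcal{A}\cup\mathcal{A}^c$ is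 the (symmetric) set of observed ordered pairs, so that $\mathcal{A}^c=\mathcal{E}\setminus\mathcal{A}$. Objective. $f(X)=\sum_{(i,j)\in\mathcal{E}}\|X_iX_j^\top-Y_{ij}\|_F$. Distances. For $X,Z\in\mathbb{R}^{nd\times d}$ let $R^\star\in\arg\min_{R\in\mathrm{SO}(d)}\|X-ZR\|_F^2$; then $\operatorname{dist}_1(X,Z)=\sum_{i=1}^n\|X_i-Z_iR^\star\|_F$ and $\operatorname{dist}_\infty(X,Z)=\max_{1\le i\le n}\|X_i-Z_iR^\star\|_F$, with the same $R^\star$. *)

(* Defs.v *)
(* MathComp-Analysis *)
From HB Require Import structures.
From mathcomp Require Import all_boot all_order all_algebra.
From mathcomp Require Import all_classical all_reals all_analysis.

Set Implicit Arguments.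
Unset Strict Implicit.
Unset Printing Implicit Defensive.

Import Order.TTheory GRing.Theory Num.Theory.
Import numFieldNormedType.Exports.

Local Open Scope classical_set_scope.
Local Open Scope ring_scope.

Definition SO (R : realType) (d : nat) : set 'M[R]_d :=
  [set Q | Q^T *m Q = 1%:M /\ \det Q = 1].
Arguments SO : clear implicits.

Definition frob (R : realType) (m n : nat) (A : 'M[R]_(m, n)) : R :=
  Num.sqrt (\sum_i \sum_j A i j ^+ 2).

(* A stacked matrix X in R^{nd x d} is given by its d x d blocks,
   X : 'I_n -> 'M_d, and Z R has blocks (Z R)_i = Z_i R. *)
Definition SOn (R : realType) (n d : nat) : set ('I_n -> 'M[R]_d) :=
  [set X | forall i, SO R d (X i)].
Arguments SOn : clear implicits.

(* The squared Frobenius norm of the stacked matrix X - Z Q. *)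
Definition sqdist (R : realType) (n d : nat) (X Z : 'I_n -> 'M[R]_d)
    (Q : 'M[R]_d) : R :=
  \sum_(i < n) frob (X i - Z i *m Q) ^+ 2.

Definition argmin_SO (R : realType) (n d : nat) (X Z : 'I_n -> 'M[R]_d) :
    set 'M[R]_d :=
  [set Q | SO R d Q /\
     forall Q', SO R d Q' -> sqdist X Z Q <= sqdist X Z Q'].

(* dist_1(X, Z) and dist_oo(X, Z) are the values at a common minimizer
   Q \in argmin_SO X Z, which need not be unique and is therefore an
   explicit argument. *)
Definition dist1 (R : realType) (n d : nat) (X Z : 'I_n -> 'M[R]_d)
    (Q : 'M[R]_d) : R :=
  \sum_(i < n) frob (X i - Z i *m Q).

Definition distoo (R : realType) (n d : nat) (X Z : 'I_n -> 'M[R]_d)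
    (Q : 'M[R]_d) : R :=
  \big[Num.max/0]_(i < n) frob (X i - Z i *m Q).

(* d x d matrices with their Borel sigma-algebra. *)
Notation borel_mx R d := (g_sigma_algebraType (@open 'M[R]_d)).

(* The Haar probability measure on SO(d), seen as a Borel measure on all
   d x d matrices; a left-invariant probability measure on SO(d) is unique. *)
Definition is_haar_SO (R : realType) (d : nat)
    (mu : probability (borel_mx R d) R) : Prop :=
  mu (SO R d) = 1%E /\
  forall (Q : 'M[R]_d) (B : set (borel_mx R d)), SO R d Q -> measurable B ->
    mu [set A | B (Q *m A)] = mu B.

Definition mutually_independent (R : realType) (disp : measure_display)
    (Omega : measurableType disp) (P : probability Omega R)
    (I : finType) (F : I -> set (set Omega)) : Prop :=
  forall (J : {set I}) (E : I -> set Omega),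
    (forall i, i \in J -> F i (E i)) ->
    P (\big[setI/setT]_(i in J) E i) = (\prod_(i in J) P (E i))%E.

Inductive edge_status := Inlier | Outlier | Missing.

Definition upper_pair (n : nat) := {e : 'I_n * 'I_n | (e.1 < e.2)%N}.

(* The randomness of the corruption model.  Only the entries i < j of
   rcm_status and rcm_noise are constrained and used. *)
Record rcm (R : realType) (d n : nat) (p q : R) (disp : measure_display)
    (Omega : measurableType disp) (P : probability Omega R) := RCM {
  rcm_status : 'I_n -> 'I_n -> Omega -> edge_status;
  rcm_noise : 'I_n -> 'I_n -> {RV P >-> borel_mx R d};
  rcm_status_measurable : forall (i j : 'I_n) (s : edge_status), (i < j)%N ->
    measurable (rcm_status i j @^-1` [set s]);
  rcm_inlier : forall i j : 'I_n, (i < j)%N ->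
    P (rcm_status i j @^-1` [set Inlier]) = (p * q)%:E;
  rcm_outlier : forall i j : 'I_n, (i < j)%N ->
    P (rcm_status i j @^-1` [set Outlier]) = ((1 - p) * q)%:E;
  rcm_missing : forall i j : 'I_n, (i < j)%N ->
    P (rcm_status i j @^-1` [set Missing]) = (1 - q)%:E;
  rcm_haar : forall i j : 'I_n, (i < j)%N ->
    is_haar_SO (distribution P (rcm_noise i j));
  rcm_indep : mutually_independent P
    (fun k : upper_pair n + upper_pair n =>
       match k with
       | inl e => preimage_set_system setT
                    (rcm_status (val e).1 (val e).2) setT
       | inr e => preimage_set_system setT
                    (rcm_noise (val e).1 (val e).2) measurable
       end)
}.

Section Data.
Context (R : realType) (d n : nat) (p q : R) (disp : measure_display)
  (Omega : measurableType disp) (P : probability Omega R).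
Variables (M : rcm d n p q P) (Xs : 'I_n -> 'M[R]_d) (w : Omega).

Definition sym_status (i j : 'I_n) : edge_status :=
  if (i < j)%N then rcm_status M i j w
  else if (j < i)%N then rcm_status M j i w
  else Missing.

Definition observed (i j : 'I_n) : bool :=
  if sym_status i j is Missing then false else true.

Definition Y_upper (i j : 'I_n) : 'M[R]_d :=
  match rcm_status M i j w with
  | Inlier => Xs i *m (Xs j)^T
  | Outlier => rcm_noise M i j w
  | Missing => 0
  end.

Definition Y (i j : 'I_n) : 'M[R]_d :=
  if (i < j)%N then Y_upper i j
  else if (j < i)%N then (Y_upper j i)^T
  else 0.

Definition objective (X : 'I_n -> 'M[R]_d) : R :=
  \sum_(e : 'I_n * 'I_n | observed e.1 e.2)
     frob (X e.1 *m (X e.2)^T - Y e.1 e.2).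

End Data.

(* Main.v *)
Require Import Defs.
From HB Require Import structures.
From mathcomp Require Import all_boot all_order all_algebra.
From mathcomp Require Import all_classical all_reals all_analysis.
From mathcomp Require Import measurable_realfun ring lra.
Import Order.TTheory GRing.Theory Num.Theory.
Import numFieldNormedType.Exports.
Set Implicit Arguments.
Unset Strict Implicit.
Unset Printing Implicit Defensive.
Local Open Scope classical_set_scope.
Local Open Scope ring_scope.

(** Write [U_i = Xs_i^T X_i Q^T] with [Q] the optimal alignment, so that
   [D_i = U_i - 1] has Frobenius norm equal to the [i]-th distance, and write
   [P = p q].  All the randomness is confined to a few scalar sums of
   independent bounded variables, after which the estimate is deterministic and
   hence uniform in [X].

   Inliers.  An inlier edge contributes [|U_i - U_j|] (Frobenius norms
   throughout).  Any two vertices have about [n P^2] common inlier neighbours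
   and the inlier degrees are about [n P], so the triangle inequality along the
   paths of length two ([sum_edges_ge]) bounds the sum over inlier edges from
   below by about [P/2] times the sum over all pairs.  Optimality of [Q] makes
   [S = sum_i U_i] symmetric ([argmin_symmetric]); as
   [sum_k (U_i - U_k) = n U_i - S] and [U_i] is orthogonal, the skew part alone
   gives [|n U_i - S| >= n |D_i| (1 - |D_i|/2)] ([frob_shift_ge]).  The inliers
   thus contribute at least about [n P/2] times dist_1; the actual constants
   give [199/900] instead of [1/2].

   Outliers.  By convexity of the norm an outlier edge contributes at least
   [<U_i U_j^T - 1, G_ij>] with [G_ij] the unit vector from the observation, read
   in the frames of the ground truth, to the identity.  Expanding
   [U_i U_j^T - 1 = D_i + D_j^T + D_i D_j^T], the quadratic terms cost at most
   of the order of [c p] times the outlier degree [n q] times dist_1: this is where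
   [dist_oo <= c p] is used.  In the linear terms only the skew part of the row
   sums of [G] matters up to quadratic terms ([outlier_sum_ge]); its mean is
   zero because the Haar measure is invariant under inversion, which follows
   from left invariance and Fubini ([haar_skew_mean]).

   Concentration.  Deviations of the row sums and degrees may be as large as a
   small multiple of [n P], and the Chernoff bound [chernoff_tail] gives each
   such deviation a probability at most [exp (- const n P^2)], hence [n^-3] when
   [P^2 >= C log n / n].  For the numbers of common neighbours the deviation is
   of order [n P^2] but so is the total variance, and the same bound results.
   A union bound over [O(n^2)] events concludes. *)

(** * The Frobenius inner product *)

Definition frobdot (R : realType) (m n : nat) (A B : 'M[R]_(m, n)) : R :=
  \tr (A^T *m B).

Section Frobenius.
Context {R : realType}.
Implicit Types (m n k d : nat).

Lemma frobdotE m n (A B : 'M[R]_(m, n)) :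
  frobdot A B = \sum_i \sum_j A i j * B i j.
Proof.
rewrite /frobdot /mxtrace exchange_big /=; apply: eq_bigr => j _.
by rewrite mxE; apply: eq_bigr => i _; rewrite mxE.
Qed.

Lemma frobdotC m n (A B : 'M[R]_(m, n)) : frobdot A B = frobdot B A.
Proof. by rewrite /frobdot -mxtrace_tr trmx_mul trmxK. Qed.

Lemma frobdotDl m n (A B C : 'M[R]_(m, n)) :
  frobdot (A + B) C = frobdot A C + frobdot B C.
Proof. by rewrite /frobdot linearD mulmxDl mxtraceD. Qed.

Lemma frobdotNl m n (A C : 'M[R]_(m, n)) : frobdot (- A) C = - frobdot A C.
Proof. by rewrite /frobdot linearN mulNmx raddfN. Qed.

Lemma frobdotZl m n a (A C : 'M[R]_(m, n)) :
  frobdot (a *: A) C = a * frobdot A C.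
Proof. by rewrite /frobdot linearZ -scalemxAl mxtraceZ. Qed.

Lemma frobdotBl m n (A B C : 'M[R]_(m, n)) :
  frobdot (A - B) C = frobdot A C - frobdot B C.
Proof. by rewrite frobdotDl frobdotNl. Qed.

Lemma frobdotDr m n (A B C : 'M[R]_(m, n)) :
  frobdot A (B + C) = frobdot A B + frobdot A C.
Proof. by rewrite frobdotC frobdotDl !(frobdotC A). Qed.

Lemma frobdotNr m n (A C : 'M[R]_(m, n)) : frobdot A (- C) = - frobdot A C.
Proof. by rewrite frobdotC frobdotNl frobdotC. Qed.

Lemma frobdotBr m n (A B C : 'M[R]_(m, n)) :
  frobdot A (B - C) = frobdot A B - frobdot A C.
Proof. by rewrite frobdotDr frobdotNr. Qed.

Lemma frobdotZr m n a (A C : 'M[R]_(m, n)) :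
  frobdot A (a *: C) = a * frobdot A C.
Proof. by rewrite frobdotC frobdotZl frobdotC. Qed.

Lemma frobdot_sumr m n (I : finType) (P : pred I) (A : 'M[R]_(m, n))
    (F : I -> 'M[R]_(m, n)) :
  frobdot A (\sum_(i | P i) F i) = \sum_(i | P i) frobdot A (F i).
Proof. by rewrite /frobdot mulmx_sumr raddf_sum. Qed.

Lemma frobdot_tr m n (A B : 'M[R]_(m, n)) : frobdot A^T B^T = frobdot A B.
Proof. by rewrite /frobdot trmxK mxtrace_mulC -mxtrace_tr trmx_mul trmxK. Qed.

Lemma sqr_frob m n (A : 'M[R]_(m, n)) : frob A ^+ 2 = frobdot A A.
Proof.
rewrite /frob sqr_sqrtr; last by do 2!apply: sumr_ge0 => ? _; rewrite sqr_ge0.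
by rewrite frobdotE.
Qed.

Lemma frob_ge0 m n (A : 'M[R]_(m, n)) : 0 <= frob A.
Proof. exact: sqrtr_ge0. Qed.
Hint Resolve frob_ge0 : core.

Lemma frobdot_ge0 m n (A : 'M[R]_(m, n)) : 0 <= frobdot A A.
Proof. by rewrite -sqr_frob sqr_ge0. Qed.

Lemma frob_sqrt m n (A : 'M[R]_(m, n)) : frob A = Num.sqrt (frobdot A A).
Proof. by rewrite -sqr_frob sqrtr_sqr ger0_norm. Qed.

Lemma frob_eq0 m n (A : 'M[R]_(m, n)) : frob A = 0 -> A = 0.
Proof.
move=> /(congr1 (fun x => x ^+ 2)); rewrite sqr_frob expr0n /= frobdotE => /eqP.
rewrite psumr_eq0; last by move=> i _; apply: sumr_ge0 => j _; rewrite -expr2 sqr_ge0.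
move=> /allP h; apply/matrixP => i j; rewrite mxE.
have := h i (mem_index_enum _); rewrite psumr_eq0; last first.
  by move=> ? _; rewrite -expr2 sqr_ge0.
by move=> /allP /(_ j (mem_index_enum _)); rewrite mulf_eq0 orbb => /eqP.
Qed.

Lemma frob_gt0 m n (A : 'M[R]_(m, n)) : A != 0 -> 0 < frob A.
Proof.
by move=> A0; rewrite lt0r frob_ge0 andbT; apply: contra_neq A0; exact: frob_eq0.
Qed.

Lemma frob0 m n : frob (0 : 'M[R]_(m, n)) = 0.
Proof. by rewrite frob_sqrt /frobdot mulmx0 raddf0 sqrtr0. Qed.

Lemma frobdot_le m n (A B : 'M[R]_(m, n)) : frobdot A B <= frob A * frob B.
Proof.
(* Positivity of the square of [frob B *: A - frob A *: B]. *)
have h : 0 <= (frob A * frob B) * (frob A * frob B - frobdot A B) *+ 2.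
  have := frobdot_ge0 (frob B *: A - frob A *: B).
  rewrite frobdotBl !frobdotBr !frobdotZl !frobdotZr (frobdotC B A) -!sqr_frob.
  lra.
have [->|A0] := eqVneq A 0.
  by rewrite frob0 mul0r /frobdot linear0 mul0mx raddf0.
have [->|B0] := eqVneq B 0.
  by rewrite frob0 mulr0 /frobdot mulmx0 raddf0.
have Ap := frob_gt0 A0.
have Bp := frob_gt0 B0.
by move: h; rewrite pmulrn_lge0// pmulr_rge0 ?mulr_gt0// subr_ge0.
Qed.

Lemma frobN m n (A : 'M[R]_(m, n)) : frob (- A) = frob A.
Proof. by rewrite !frob_sqrt frobdotNl frobdotNr opprK. Qed.

Lemma frobdot_ge m n (A B : 'M[R]_(m, n)) : - (frob A * frob B) <= frobdot A B.
Proof. by rewrite lerNl -frobdotNl (le_trans (frobdot_le _ _))// frobN. Qed.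

Lemma frobD_le m n (A B : 'M[R]_(m, n)) : frob (A + B) <= frob A + frob B.
Proof.
rewrite -(ler_pXn2r (_ : 0 < 2)%N)// ?nnegrE ?addr_ge0//.
rewrite sqr_frob frobdotDl !frobdotDr (frobdotC B A) sqrrD !sqr_frob.
have := frobdot_le A B; lra.
Qed.

Lemma frob_sum_le m n (I : finType) (P : pred I) (F : I -> 'M[R]_(m, n)) :
  frob (\sum_(i | P i) F i) <= \sum_(i | P i) frob (F i).
Proof.
elim/big_rec2 : _ => [|i x A _ h]; first by rewrite frob0.
by rewrite (le_trans (frobD_le _ _))// lerD2l.
Qed.

Lemma frob_tr m n (A : 'M[R]_(m, n)) : frob A^T = frob A.
Proof. by rewrite !frob_sqrt frobdot_tr. Qed.

Lemma frobZ m n a (A : 'M[R]_(m, n)) : 0 <= a -> frob (a *: A) = a * frob A.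
Proof.
move=> a0; rewrite !frob_sqrt frobdotZl frobdotZr mulrA -expr2.
by rewrite sqrtrM ?sqr_ge0// sqrtr_sqr ger0_norm.
Qed.

Lemma frob_mulmx_le m n k (A : 'M[R]_(m, n)) (B : 'M[R]_(n, k)) :
  frob (A *m B) <= frob A * frob B.
Proof.
rewrite -(ler_pXn2r (_ : 0 < 2)%N)// ?nnegrE ?mulr_ge0// exprMn !sqr_frob.
rewrite -(frobdot_tr B) !frobdotE mulr_suml; apply: ler_sum => i _.
rewrite mulr_sumr; apply: ler_sum => j _; rewrite -expr2.
have -> : (A *m B) i j = frobdot (row i A) (row j B^T).
  by rewrite frobdotE big_ord1 mxE; apply: eq_bigr => l _; rewrite !mxE.
have -> : \sum_l A i l * A i l = frob (row i A) ^+ 2.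
  by rewrite sqr_frob frobdotE big_ord1; apply: eq_bigr => l _; rewrite !mxE.
have -> : \sum_l B^T j l * B^T j l = frob (row j B^T) ^+ 2.
  by rewrite sqr_frob frobdotE big_ord1; apply: eq_bigr => l _; rewrite !mxE.
rewrite -exprMn -real_normK ?num_real//.
rewrite ler_pXn2r// ?nnegrE ?mulr_ge0// ler_norml frobdot_le andbT.
exact: frobdot_ge.
Qed.

Lemma frob_orthl d n (Q : 'M[R]_d) (A : 'M[R]_(d, n)) :
  Q^T *m Q = 1%:M -> frob (Q *m A) = frob A.
Proof.
by move=> h; rewrite !frob_sqrt /frobdot trmx_mul mulmxA -(mulmxA A^T) h mulmx1.
Qed.

Lemma frob_orthr d n (Q : 'M[R]_d) (A : 'M[R]_(n, d)) :
  Q^T *m Q = 1%:M -> frob (A *m Q) = frob A.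
Proof.
move=> /mulmx1C h.
by rewrite -frob_tr trmx_mul frob_orthl ?trmxK// frob_tr.
Qed.

Lemma frob_entries_le d (A : 'M[R]_d) (e : R) : 0 <= e ->
  (forall i j, `|A i j| <= e) -> frob A <= d%:R * e.
Proof.
move=> e0 h; rewrite -(ler_pXn2r (_ : 0 < 2)%N)// ?nnegrE ?mulr_ge0//.
rewrite sqr_frob frobdotE exprMn.
have -> : d%:R ^+ 2 * e ^+ 2 = \sum_(i < d) \sum_(j < d) e ^+ 2.
  by rewrite !sumr_const card_ord -mulr_natl -[e ^+2 *+ d]mulr_natl; ring.
do 2!apply: ler_sum => ? _; rewrite -expr2 -real_normK ?num_real//.
by rewrite ler_pXn2r// nnegrE.
Qed.

(** Convexity: [(frob A)^-1 *: A] is a subgradient of the norm at [A].  At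
   [A = 0] the convention [0^-1 = 0] selects the subgradient [0]. *)
Lemma frob_subgradient m n (A B : 'M[R]_(m, n)) :
  frobdot (B - A) ((frob A)^-1 *: A) <= frob B - frob A.
Proof.
have [->|A0] := eqVneq A 0.
  by rewrite scaler0 frob0 !subr0 /frobdot mulmx0 raddf0.
have Ap := frob_gt0 A0.
rewrite frobdotZr ler_pdivrMl// frobdotBl -sqr_frob mulrBr expr2 lerB//.
by rewrite mulrC frobdot_le.
Qed.

Lemma frob_normalize_le1 m n (A : 'M[R]_(m, n)) : frob ((frob A)^-1 *: A) <= 1.
Proof.
rewrite frobZ ?invr_ge0//; have [->|A0] := eqVneq (frob A) 0.
  by rewrite mulr0.
by rewrite mulVf.
Qed.

Lemma frob_entry_le m n (A : 'M[R]_(m, n)) i j : `|A i j| <= frob A.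
Proof.
rewrite -(ler_pXn2r (_ : 0 < 2)%N)// ?nnegrE// real_normK ?num_real//.
rewrite sqr_frob frobdotE (bigD1 i)//= (bigD1 j)//= -expr2 -addrA lerDl.
by rewrite addr_ge0 ?sumr_ge0// => *; rewrite ?sumr_ge0// => *; rewrite -expr2 sqr_ge0.
Qed.

End Frobenius.
#[export] Hint Extern 0 (is_true (0 <= frob _)) => exact: frob_ge0 : core.

(** * Alignment: first-order optimality over the rotation group *)

Section PlaneRotations.
Context {R : realType} {d : nat}.
Variables (a b : 'I_d).
Hypothesis ab : a != b.

Let Pl : 'M[R]_d := delta_mx a a + delta_mx b b.
Let Jl : 'M[R]_d := delta_mx a b - delta_mx b a.

Definition plane_rot (c s : R) : 'M[R]_d := 1%:M + (c - 1) *: Pl + s *: Jl.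

Let PP : Pl *m Pl = Pl.
Proof.
rewrite /Pl mulmxDl !mulmxDr !mul_delta_mx_cond !eqxx (negbTE ab) eq_sym (negbTE ab).
by rewrite !mulr1n !mulr0n addr0 add0r.
Qed.

Let PJ : Pl *m Jl = Jl.
Proof.
rewrite /Pl /Jl mulmxDl !mulmxBr !mul_delta_mx_cond !eqxx.
rewrite (negbTE ab) eq_sym (negbTE ab).
by rewrite !mulr1n !mulr0n subr0 sub0r.
Qed.

Let JP : Jl *m Pl = Jl.
Proof.
rewrite /Pl /Jl mulmxBl !mulmxDr !mul_delta_mx_cond !eqxx.
rewrite (negbTE ab) eq_sym (negbTE ab).
by rewrite !mulr1n !mulr0n addr0 add0r.
Qed.

Let JJ : Jl *m Jl = - Pl.
Proof.
rewrite /Pl /Jl mulmxBl !mulmxBr !mul_delta_mx_cond !eqxx.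
rewrite (negbTE ab) eq_sym (negbTE ab).
by rewrite !mulr1n !mulr0n subr0 sub0r opprD.
Qed.

Let trP : Pl^T = Pl.
Proof. by rewrite /Pl linearD /= !trmx_delta. Qed.

Let trJ : Jl^T = - Jl.
Proof. by rewrite /Jl linearB /= !trmx_delta opprB. Qed.

Let mulPJ (x y z t : R) :
  (1%:M + x *: Pl + y *: Jl) *m (1%:M + z *: Pl + t *: Jl) =
  1%:M + (x + z + x * z - y * t) *: Pl + (y + t + x * t + y * z) *: Jl.
Proof.
rewrite !(mulmxDl, mulmxDr, mul1mx, mulmx1) -!scalemxAl -!scalemxAr PP PJ JP JJ.
by apply/matrixP => i j; rewrite !mxE; ring.
Qed.

Lemma plane_rot_orth c s : c ^+ 2 + s ^+ 2 = 1 ->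
  (plane_rot c s)^T *m plane_rot c s = 1%:M.
Proof.
move=> cs.
have -> : (plane_rot c s)^T = 1%:M + (c - 1) *: Pl + (- s) *: Jl.
  rewrite /plane_rot 2!linearD /= 2!linearZ /= trP trJ trmx1.
  by rewrite scalerN scaleNr.
rewrite mulPJ.
have -> : c - 1 + (c - 1) + (c - 1) * (c - 1) - - s * s = 0.
  by have -> : 0 = c ^+ 2 + s ^+ 2 - 1; [rewrite cs subrr|ring].
have -> : - s + s + (c - 1) * s + - s * (c - 1) = 0 by ring.
by rewrite !scale0r !addr0.
Qed.

Lemma frobdot_plane_rot2 (S : 'M[R]_d) c s : c ^+ 2 + s ^+ 2 = 1 ->
  frobdot S (plane_rot c s *m plane_rot c s) =
  frobdot S 1%:M - s ^+ 2 *+ 2 * (S a a + S b b) + c * s *+ 2 * (S a b - S b a).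
Proof.
move=> cs; rewrite mulPJ !frobdotDr !frobdotZr.
have dE i j : frobdot S (delta_mx i j) = S i j.
  rewrite frobdotE (bigD1 i)//= (bigD1 j)//= mxE !eqxx mulr1 !big1 ?addr0//.
    move=> k ki; rewrite big1// => l _.
    by rewrite mxE (negbTE ki) mulr0.
  by move=> l lj; rewrite mxE (negbTE lj) andbF mulr0.
rewrite /Pl /Jl frobdotDr frobdotBr !dE.
have -> : c - 1 + (c - 1) + (c - 1) * (c - 1) - s * s = - (s ^+ 2 *+ 2).
  have -> : - (s ^+ 2 *+ 2) = c ^+ 2 - s ^+ 2 - (c ^+ 2 + s ^+ 2) by ring.
  by rewrite cs; ring.
by ring.
Qed.

End PlaneRotations.

Section FirstOrderOptimality.
Context {R : realType}.
Implicit Types n d : nat.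

(** A maximizer over SO(d) of a linear functional is a critical point, and the
   tangent space at the identity consists of the skew matrices.  Only the
   squares of plane rotations are used as competitors: for them the determinant
   is a square of +-1, hence 1.  The rational parametrization of the circle
   avoids derivatives. *)
Lemma symmetric_of_max d (S : 'M[R]_d) :
  (forall H : 'M[R]_d, H^T *m H = 1%:M -> frobdot S (H *m H) <= frobdot S 1%:M) ->
  S^T = S.
Proof.
move=> h.
have le a b : a != b -> S a b <= S b a.
  move=> ab; rewrite leNgt; apply/negP => lt.
  set be := S a b - S b a; have be0 : 0 < be by rewrite /be subr_gt0.
  set al := S a a + S b b.
  have hmax c s : c ^+ 2 + s ^+ 2 = 1 -> c * s * be <= s ^+ 2 * al.
    move=> cs; have := h _ (plane_rot_orth ab cs).
    by rewrite frobdot_plane_rot2// -/al -/be; lra.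
  have al0 : 0 <= `|al| by [].
  (* The half-angle tangent [t] is so small that the first-order term
     [2 t (1 - t^2) be] beats the second-order term [4 t^2 al]. *)
  pose t := be / (4 * (`|al| + be)).
  have t0 : 0 < t by rewrite /t divr_gt0// mulr_gt0// ltr_wpDl.
  have tE : t * (4 * (`|al| + be)) = be.
    by rewrite /t divfK// mulf_neq0// gt_eqF// ltr_wpDl.
  have t4 : t <= 4^-1.
    by rewrite /t ler_pdivrMr; lra.
  have u0 : 0 < 1 + t ^+ 2 by rewrite ltr_wpDr ?sqr_ge0.
  have u0' := lt0r_neq0 u0.
  have := hmax ((1 - t ^+ 2) / (1 + t ^+ 2)) (2 * t / (1 + t ^+ 2)).
  have -> : ((1 - t ^+ 2) / (1 + t ^+ 2)) ^+ 2 + (2 * t / (1 + t ^+ 2)) ^+ 2 = 1.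
    by field.
  move=> /(_ erefl).
  have -> : (1 - t ^+ 2) / (1 + t ^+ 2) * (2 * t / (1 + t ^+ 2)) * be =
    (2 * t / (1 + t ^+ 2) ^+ 2) * ((1 - t ^+ 2) * be) by field.
  have -> : (2 * t / (1 + t ^+ 2)) ^+ 2 * al =
    (2 * t / (1 + t ^+ 2) ^+ 2) * (2 * t * al) by field.
  have pr : 0 < 2 * t / (1 + t ^+ 2) ^+ 2.
    by rewrite divr_gt0 ?exprn_gt0//; exact: mulr_gt0.
  rewrite ler_pM2l//.
  have : t * al <= t * `|al| by rewrite ler_pM2l// ler_norm.
  have : t ^+ 2 * be <= 16^-1 * be.
    rewrite ler_pM2r//; have -> : 16^-1 = 4^-1 ^+ 2 :> R by field.
    by rewrite ler_pXn2r// nnegrE ltW// invr_gt0.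
  have : 0 < t * be by rewrite mulr_gt0.
  lra.
apply/matrixP => i j; rewrite mxE.
have [->//|ij] := eqVneq i j.
by apply/eqP; rewrite eq_le !le// eq_sym.
Qed.

Lemma SO_mul d (A B : 'M[R]_d) : SO R d A -> SO R d B -> SO R d (A *m B).
Proof.
move=> [A1 A2] [B1 B2]; split; last by rewrite det_mulmx A2 B2 mulr1.
by rewrite trmx_mul mulmxA -(mulmxA B^T) A1 mulmx1.
Qed.

Lemma SO_tr d (A : 'M[R]_d) : SO R d A -> SO R d A^T.
Proof. by move=> [A1 A2]; split; [rewrite trmxK (mulmx1C A1)|rewrite det_tr]. Qed.

Lemma SO_sqr d (H : 'M[R]_d) : H^T *m H = 1%:M -> SO R d (H *m H).
Proof.
move=> h; split; first by rewrite trmx_mul mulmxA -(mulmxA H^T) h mulmx1.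
by have := congr1 determinant h; rewrite !det_mulmx det_tr det1.
Qed.

Lemma argmin_symmetric n d (X Z : 'I_n -> 'M[R]_d) Q :
  SOn R n d Z -> argmin_SO X Z Q ->
  let S := \sum_i (Z i)^T *m X i *m Q^T in S^T = S.
Proof.
move=> hZ [hQ hmin] S; apply: symmetric_of_max => H hH.
have sqE Q' : SO R d Q' -> sqdist X Z Q' =
    \sum_i (frob (X i) ^+ 2 + frob (1%:M : 'M[R]_d) ^+ 2)
    - 2 * \sum_i frobdot (X i) (Z i *m Q').
  move=> [hQ' _]; rewrite /sqdist mulr_sumr -sumrB; apply: eq_bigr => i _.
  have [hz _] := hZ i.
  rewrite sqr_frob frobdotBl !frobdotBr (frobdotC (Z i *m Q')) -!sqr_frob.
  have -> : frob (Z i *m Q') = frob (1%:M : 'M[R]_d).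
    by rewrite frob_orthr// -[Z i]mulmx1 frob_orthl.
  by ring.
have := hmin _ (SO_mul (SO_sqr hH) hQ).
rewrite !sqE//; last exact: SO_mul (SO_sqr hH) hQ.
have dotE G : \sum_i frobdot (X i) (Z i *m (G *m Q)) = frobdot S G.
  rewrite frobdotC frobdot_sumr; apply: eq_bigr => i _.
  rewrite [RHS]frobdotC /frobdot !trmx_mul !trmxK.
  by rewrite -!mulmxA [RHS]mxtrace_mulC -!mulmxA.
rewrite -{1}[Q]mul1mx !dotE; lra.
Qed.

End FirstOrderOptimality.

(** * Deterministic estimates for inlier and outlier sums *)

Section DeterministicBounds.
Context {R : realType}.
Implicit Types n d : nat.

(** Bound [w i k] by [w i j + w j k] for each common neighbour [j] of [i] and
   [k].  Summing over all triples, an edge occurs at most [2 * D] times, once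
   for each path of length two that starts or ends with it. *)
Lemma sum_edges_ge n (a : rel 'I_n) (w : 'I_n -> 'I_n -> R) (N D : R) :
  symmetric a -> (forall i j, 0 <= w i j) -> (forall i, w i i = 0) ->
  (forall i j k, w i k <= w i j + w j k) ->
  (forall i k, i != k -> N <= \sum_j ((a i j)%:R * (a k j)%:R)) ->
  (forall i, \sum_j (a i j)%:R <= D) ->
  N * (\sum_i \sum_k w i k) <= 2 * D * (\sum_i \sum_j (a i j)%:R * w i j).
Proof.
move=> asym w0 wd wt hN hD.
have b0 (b : bool) : 0 <= b%:R :> R by rewrite ler0n.
apply: (@le_trans _ _
  (\sum_i \sum_k \sum_j ((a i j)%:R * (a k j)%:R) * (w i j + w j k))).
  rewrite mulr_sumr; apply: ler_sum => i _; rewrite mulr_sumr; apply: ler_sum => k _.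
  have [->|ik] := eqVneq i k.
    by rewrite wd mulr0 sumr_ge0// => j _; rewrite mulr_ge0 ?mulr_ge0 ?addr_ge0.
  apply: (@le_trans _ _ ((\sum_j (a i j)%:R * (a k j)%:R) * w i k)).
    by rewrite ler_wpM2r// hN.
  rewrite mulr_suml; apply: ler_sum => j _.
  by rewrite ler_wpM2l// mulr_ge0.
set T := \sum_i \sum_j (a i j)%:R * w i j.
have e1 : \sum_i \sum_k \sum_j (a i j)%:R * (a k j)%:R * w i j <= D * T.
  rewrite /T mulr_sumr; apply: ler_sum => i _; rewrite exchange_big mulr_sumr /=.
  apply: ler_sum => j _.
  rewrite (eq_bigr (fun k => (a j k)%:R * ((a i j)%:R * w i j))); last first.
    by move=> k _; rewrite (asym k j); ring.
  by rewrite -mulr_suml ler_wpM2r// mulr_ge0.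
have e2 : \sum_i \sum_k \sum_j (a i j)%:R * (a k j)%:R * w j k <= D * T.
  have -> : T = \sum_k \sum_j (a j k)%:R * w j k by rewrite /T exchange_big.
  rewrite exchange_big mulr_sumr /=; apply: ler_sum => k _.
  rewrite exchange_big mulr_sumr /=.
  apply: ler_sum => j _.
  rewrite (eq_bigr (fun i => (a j i)%:R * ((a j k)%:R * w j k))); last first.
    by move=> i _; rewrite (asym i j) (asym k j); ring.
  by rewrite -mulr_suml ler_wpM2r// mulr_ge0.
rewrite (_ : \sum_i _ = (\sum_i \sum_k \sum_j (a i j)%:R * (a k j)%:R * w i j)
   + (\sum_i \sum_k \sum_j (a i j)%:R * (a k j)%:R * w j k)).
  by have -> : 2 * D * T = D * T + D * T; [ring|exact: lerD].
rewrite -big_split; apply: eq_bigr => i _; rewrite -big_split; apply: eq_bigr => k _.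
by rewrite -big_split; apply: eq_bigr => j _; rewrite mulrDr.
Qed.

(** Rotations leave the identity in skew directions: the symmetric part of
   [U - 1] is quadratic in [U - 1]. *)
Lemma orth_sym_part d (U : 'M[R]_d) : U^T *m U = 1%:M ->
  (U - 1%:M) + (U - 1%:M)^T = - ((U - 1%:M) *m (U - 1%:M)^T).
Proof.
move=> /mulmx1C h.
rewrite linearB /= trmx1 mulmxBl !mulmxBr h !mul1mx mulmx1.
by apply/matrixP => i j; rewrite !mxE; ring.
Qed.

(** Since [S] is symmetric, the skew part of [n *: U - S] is that of [n *: U],
   and it is carried by the first-order part of [U - 1]. *)
Lemma frob_shift_ge d (U S : 'M[R]_d) (m de : R) : U^T *m U = 1%:M -> S^T = S ->
  0 <= m -> frob (U - 1%:M) <= de ->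
  m * (1 - de / 2) * frob (U - 1%:M) <= frob (m *: U - S).
Proof.
move=> hU hS m0 hde.
have : frob ((m *: U - S) - (m *: U - S)^T) <= 2 * frob (m *: U - S).
  by rewrite (le_trans (frobD_le _ _))// frobN frob_tr -mulr2n mulr_natl.
have -> : (m *: U - S) - (m *: U - S)^T =
   m *: (2 *: (U - 1%:M) + (U - 1%:M) *m (U - 1%:M)^T).
  rewrite -[_ *m _]opprK -orth_sym_part//.
  have -> : (m *: U - S)^T = m *: U^T - S by rewrite linearB /= linearZ /= hS.
  have -> : (U - 1%:M)^T = U^T - 1%:M by rewrite linearB /= trmx1.
  by apply/matrixP => i j; rewrite !mxE; ring.
rewrite frobZ//.
set D : 'M[R]_d := U - 1%:M in hde *.
have h1 : 2 * frob D - frob D * de <= frob (2 *: D + D *m D^T).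
  have := frobD_le (2 *: D + D *m D^T) (- (D *m D^T)); rewrite addrK frobN frobZ//.
  have := frob_mulmx_le D D^T; rewrite frob_tr.
  have : frob D * frob D <= frob D * de by rewrite ler_wpM2l.
  lra.
have : m * (2 * frob D - frob D * de) <= m * frob (2 *: D + D *m D^T).
  by rewrite ler_wpM2l.
lra.
Qed.

(** Combines [sum_edges_ge] for [w i j = frob (U i - U j)] with
   [frob_shift_ge], through [\sum_k (U i - U k) = n *: U i - \sum_k U k]. *)
Lemma inlier_sum_ge n d (U : 'I_n -> 'M[R]_d) (a : rel 'I_n) (N D de : R) :
  (forall i, (U i)^T *m U i = 1%:M) -> (\sum_i U i)^T = \sum_i U i ->
  (forall i, frob (U i - 1%:M) <= de) ->
  symmetric a -> 0 <= N ->
  (forall i k, i != k -> N <= \sum_j ((a i j)%:R * (a k j)%:R)) ->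
  (forall i, \sum_j (a i j)%:R <= D) ->
  N * (n%:R * (1 - de / 2)) * (\sum_i frob (U i - 1%:M)) <=
  2 * D * (\sum_i \sum_j (a i j)%:R * frob (U i - U j)).
Proof.
move=> hU hS hde asym N0 hN hD.
apply: le_trans (sum_edges_ge (w := fun i j => frob (U i - U j)) asym _ _ _ hN hD) => //.
- rewrite -mulrA ler_wpM2l// mulr_sumr; apply: ler_sum => i _.
  apply: (le_trans (frob_shift_ge (hU i) hS _ (hde i))); first by rewrite ler0n.
  have -> : n%:R *: U i - \sum_k U k = \sum_k (U i - U k).
    by rewrite sumrB sumr_const card_ord scaler_nat.
  exact: frob_sum_le.
- by move=> i; rewrite subrr frob0.
- by move=> i j k; rewrite -[U i - U k](subrKA (U j)) frobD_le.
Qed.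

(** The linearization of the outlier part.  With [D i = U i - 1],
   [U i *m (U j)^T - 1 = D i + (D j)^T + D i *m (D j)^T]; the linear terms only
   see the skew parts of the row sums of [G], everything else is quadratic in
   [D] and is bounded through the degrees. *)
Lemma outlier_sum_ge n d (U : 'I_n -> 'M[R]_d) (o : rel 'I_n)
    (G : 'I_n -> 'I_n -> 'M[R]_d) (Do ka de : R) :
  (forall i, (U i)^T *m U i = 1%:M) ->
  (forall i, frob (U i - 1%:M) <= de) -> 0 <= de ->
  symmetric o -> (forall i j, G j i = (G i j)^T) ->
  (forall i j, frob (G i j) <= 1) ->
  (forall i, \sum_j (o i j)%:R <= Do) -> 0 <= ka ->
  (forall i x y, \sum_j (o i j)%:R * (G i j x y - G i j y x) <= ka) ->
  - ((d%:R * ka + 2 * de * Do) * (\sum_i frob (U i - 1%:M))) <=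
  \sum_i \sum_j (o i j)%:R * frobdot (U i *m (U j)^T - 1%:M) (G i j).
Proof.
move=> hU hde de0 osym Gsym G1 hDo ka0 hka.
have b0 (b : bool) : 0 <= b%:R :> R by rewrite ler0n.
pose D i : 'M[R]_d := U i - 1%:M; pose S i : 'M[R]_d := \sum_j (o i j)%:R *: G i j.
have S_le i : frob (S i) <= Do.
  apply: le_trans (frob_sum_le _ _) _; apply: le_trans (hDo i); apply: ler_sum => j _.
  by rewrite frobZ// ler_piMr.
have -> : \sum_i \sum_j (o i j)%:R * frobdot (U i *m (U j)^T - 1%:M) (G i j) =
   \sum_i (frobdot (D i + D i) (S i)) +
   \sum_i \sum_j (o i j)%:R * frobdot (D i *m (D j)^T) (G i j).
  transitivity (\sum_i \sum_j ((o i j)%:R * frobdot (D i) (G i j)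
      + (o i j)%:R * frobdot (D j)^T (G i j)
      + (o i j)%:R * frobdot (D i *m (D j)^T) (G i j))).
    apply: eq_bigr => i _; apply: eq_bigr => j _.
    rewrite -!mulrDr -!frobdotDl; congr (_ * frobdot _ _).
    rewrite /D linearB /= trmx1 mulmxBl !mulmxBr !mul1mx mulmx1.
    by apply/matrixP => x y; rewrite !mxE; ring.
  have e1 : \sum_i \sum_j (o i j)%:R * frobdot (D i) (G i j) = \sum_i frobdot (D i) (S i).
    apply: eq_bigr => i _; rewrite frobdot_sumr; apply: eq_bigr => j _.
    by rewrite frobdotZr.
  have e2 : \sum_i \sum_j (o i j)%:R * frobdot (D j)^T (G i j) = \sum_i frobdot (D i) (S i).
    rewrite exchange_big /= -e1; apply: eq_bigr => j _; apply: eq_bigr => i _.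
    by rewrite osym Gsym frobdot_tr.
  rewrite [RHS]addrC; under [X in _ = _ + X]eq_bigr do rewrite frobdotDl.
  rewrite big_split /= -{1}e1 -e2 addrC -2!big_split; apply: eq_bigr => i _.
  rewrite -2!big_split; apply: eq_bigr => j _ /=; ring.
rewrite (_ : - _ = \sum_i - ((d%:R * ka + de * Do) * frob (D i))
   + \sum_i - (de * Do * frob (D i))); last first.
  by rewrite !sumrN -!mulr_sumr -/(D _); ring.
apply: lerD; apply: ler_sum => i _.
  have -> : D i + D i = (D i - (D i)^T) - D i *m (D i)^T.
    rewrite -orth_sym_part//; apply/matrixP => x y; rewrite !mxE; ring.
  rewrite frobdotBl.
  have h1 : - (frob (D i) * (d%:R * ka)) <= frobdot (D i - (D i)^T) (S i).
    have -> : frobdot (D i - (D i)^T) (S i) = frobdot (D i) (S i - (S i)^T).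
      by rewrite frobdotBl frobdotBr -(frobdot_tr (D i) (S i)^T) trmxK.
    apply: le_trans (frobdot_ge _ _); rewrite lerN2 ler_wpM2l//.
    apply: frob_entries_le => // x y.
    have SE u v : (S i - (S i)^T) u v = \sum_j (o i j)%:R * (G i j u v - G i j v u).
      rewrite !mxE !summxE -sumrB; apply: eq_bigr => j _; rewrite !mxE; ring.
    rewrite ler_norml {2}SE hka andbT lerNl.
    have -> : - (S i - (S i)^T) x y = (S i - (S i)^T) y x by rewrite !mxE; ring.
    by rewrite SE hka.
  have h2 : frobdot (D i *m (D i)^T) (S i) <= frob (D i) * (de * Do).
    apply: le_trans (frobdot_le _ _) _; rewrite mulrA.
    apply: (@le_trans _ _ (frob (D i *m (D i)^T) * Do)); first by rewrite ler_wpM2l.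
    rewrite ler_wpM2r//; first exact: le_trans (frob_ge0 _) (S_le i).
    apply: le_trans (frob_mulmx_le _ _) _; rewrite frob_tr ler_wpM2l//.
    exact: hde.
  have -> : - ((d%:R * ka + de * Do) * frob (D i)) =
     - (frob (D i) * (d%:R * ka)) - frob (D i) * (de * Do) by ring.
  exact: lerB.
apply: (@le_trans _ _ (\sum_j - ((o i j)%:R * (de * frob (D i))))).
  rewrite sumrN lerN2 -mulr_suml.
  have : (\sum_j (o i j)%:R) * (de * frob (D i)) <= Do * (de * frob (D i)).
    by rewrite ler_wpM2r// mulr_ge0.
  lra.
apply: ler_sum => j _; rewrite -mulrN ler_wpM2l//.
apply: le_trans (frobdot_ge _ _); rewrite lerN2.
apply: (@le_trans _ _ (frob (D i *m (D j)^T) * 1)); first by rewrite ler_wpM2l.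
rewrite mulr1 (le_trans (frob_mulmx_le _ _))// frob_tr mulrC ler_wpM2r//.
exact: hde.
Qed.

End DeterministicBounds.

(** * Means of bounded measurable functions *)

Section BoundedMeasurable.
Context {R : realType} {disp : measure_display} {T : measurableType disp}.
Implicit Types f g : T -> R.

Definition bounded_mfun f := measurable_fun setT f /\ exists B, forall x, `|f x| <= B.

Lemma bounded_mfun_cst (c : R) : bounded_mfun (fun=> c).
Proof. by split; [exact: measurable_cst|exists `|c|]. Qed.

Lemma bounded_mfunD f g : bounded_mfun f -> bounded_mfun g ->
  bounded_mfun (fun x => f x + g x).
Proof.
move=> [mf [A fA]] [mg [B gB]]; split; first exact: measurable_funD.
by exists (A + B) => x; rewrite (le_trans (ler_normD _ _))// lerD.
Qed.

Lemma bounded_mfunM f g : bounded_mfun f -> bounded_mfun g ->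
  bounded_mfun (fun x => f x * g x).
Proof.
move=> [mf [A fA]] [mg [B gB]]; split; first exact: measurable_funM.
by exists (A * B) => x; rewrite normrM ler_pM.
Qed.

Lemma bounded_mfunZ c f : bounded_mfun f -> bounded_mfun (fun x => c * f x).
Proof. exact: bounded_mfunM (bounded_mfun_cst c). Qed.

Lemma bounded_mfunB f g : bounded_mfun f -> bounded_mfun g ->
  bounded_mfun (fun x => f x - g x).
Proof.
move=> bf bg; under [X in bounded_mfun X]funext do rewrite -mulN1r.
exact: bounded_mfunD (bounded_mfunZ _ bg).
Qed.

Lemma bounded_mfun_sum (I : Type) (s : seq I) (P : pred I) (f : I -> T -> R) :
  (forall i, bounded_mfun (f i)) ->
  bounded_mfun (fun x => \sum_(i <- s | P i) f i x).
Proof.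
move=> h; elim: s => [|i s ih].
  by under [X in bounded_mfun X]funext do rewrite big_nil; exact: bounded_mfun_cst.
under [X in bounded_mfun X]funext do rewrite big_cons.
by case: (P i) => //; exact: bounded_mfunD.
Qed.

Lemma bounded_mfun_prod (I : Type) (s : seq I) (f : I -> T -> R) :
  (forall i, bounded_mfun (f i)) ->
  bounded_mfun (fun x => \prod_(i <- s) f i x).
Proof.
move=> h; elim: s => [|i s ih].
  by under [X in bounded_mfun X]funext do rewrite big_nil; exact: bounded_mfun_cst.
under [X in bounded_mfun X]funext do rewrite big_cons.
exact: bounded_mfunM.
Qed.

Lemma bounded_mfun_expR f : bounded_mfun f -> bounded_mfun (fun x => expR (f x)).
Proof.
move=> [mf [B fB]]; split; first exact: measurableT_comp.
exists (expR B) => x; rewrite gtr0_norm ?expR_gt0// ler_expR.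
exact: le_trans (ler_norm _) (fB x).
Qed.

Lemma bounded_mfun_indic (A : set T) : measurable A -> bounded_mfun (\1_A : T -> R).
Proof.
move=> mA; split; first exact: measurable_indic.
by exists 1 => x; rewrite indicE; case: (_ \in _); rewrite ?normr1 ?normr0.
Qed.

End BoundedMeasurable.

Section Expectation.
Context {R : realType} {disp : measure_display} {T : measurableType disp}.
Variable P : probability T R.
Implicit Types f g : T -> R.
Local Notation "''E' f" := (Rintegral P setT f) (at level 10, f at level 9).

Lemma bounded_mfun_integrable f : bounded_mfun f -> P.-integrable setT (EFin \o f).
Proof.
move=> [mf [B fB]]; apply: measurable_bounded_integrable => //.
  by rewrite (le_lt_trans (probability_le1 _ _))// ltry.
exists B; split; first exact: num_real.
by move=> M BM x _ /=; rewrite (le_trans (fB x))// ltW.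
Qed.

Lemma mean_cst (c : R) : 'E (fun=> c) = c.
Proof.
rewrite Rintegral_cst// (_ : fine _ = 1) ?mulr1//.
exact: (congr1 fine (probability_setT P)).
Qed.

Lemma meanD f g : bounded_mfun f -> bounded_mfun g ->
  'E (fun x => f x + g x) = 'E f + 'E g.
Proof. by move=> bf bg; rewrite RintegralD//; exact: bounded_mfun_integrable. Qed.

Lemma meanB f g : bounded_mfun f -> bounded_mfun g ->
  'E (fun x => f x - g x) = 'E f - 'E g.
Proof. by move=> bf bg; rewrite RintegralB//; exact: bounded_mfun_integrable. Qed.

Lemma meanZ c f : bounded_mfun f -> 'E (fun x => c * f x) = c * 'E f.
Proof. by move=> bf; rewrite RintegralZl//; exact: bounded_mfun_integrable. Qed.

Lemma mean_sum (I : Type) (s : seq I) (f : I -> T -> R) :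
  (forall i, bounded_mfun (f i)) ->
  'E (fun x => \sum_(i <- s) f i x) = \sum_(i <- s) 'E (f i).
Proof.
move=> h; elim: s => [|i s ih].
  rewrite big_nil -[RHS](mean_cst 0).
  by congr Rintegral; apply/funext => x; rewrite big_nil.
rewrite big_cons -ih -meanD//; last exact: bounded_mfun_sum.
by congr Rintegral; apply/funext => x; rewrite big_cons.
Qed.

Lemma mean_le f g : bounded_mfun f -> bounded_mfun g -> (forall x, f x <= g x) ->
  'E f <= 'E g.
Proof. by move=> bf bg h; apply: le_Rintegral => //; exact: bounded_mfun_integrable. Qed.

Lemma mean_indic (A : set T) : measurable A -> ('E (\1_A : T -> R))%:E = P A.
Proof.
move=> mA; rewrite /Rintegral fineK.
  by rewrite integral_indic// setIT.
rewrite integral_indic// setIT; exact: fin_num_measure.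
Qed.

Lemma le_norm_mean f (B : R) : bounded_mfun f -> (forall x, `|f x| <= B) -> `|'E f| <= B.
Proof.
move=> bf h; rewrite -(mean_cst B) ler_norml; apply/andP; split.
  rewrite mean_cst -[X in X <= _]mean_cst; apply: mean_le => //; first exact: bounded_mfun_cst.
  by move=> x; have := h x; rewrite ler_norml => /andP[].
apply: mean_le => //; first exact: bounded_mfun_cst.
by move=> x; have := h x; rewrite ler_norml => /andP[].
Qed.

(** A function with values in [0, 1] is the uniform limit of the averages of
   the indicators of its level sets, so a bounded factor that decorrelates from
   all level sets of [g] decorrelates from [g]. *)
Lemma mean_mul_of_level_sets01 (g H : T -> R) (c : R) :
  bounded_mfun g -> bounded_mfun H -> (forall x, 0 <= g x <= 1) ->
  (forall t, 'E (fun x => \1_[set y | t <= g y] x * H x) =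
     'E (\1_[set y | t <= g y] : T -> R) * c) ->
  'E (fun x => g x * H x) = 'E g * c.
Proof.
move=> bg bH g01 h.
have mlev t : measurable [set y | t <= g y].
  rewrite -[X in measurable X]setTI; apply: measurable_fun_le => //.
  by case: bg.
have blev t := bounded_mfun_indic (mlev t).
have [_ [B HB]] := bH.
have B0 : 0 <= B by apply: le_trans (HB point).
(* [gm m x] is [g x] rounded down to a multiple of [1 / m.+1]. *)
pose gm (m : nat) x : R :=
  m.+1%:R^-1 * \sum_(k < m.+1) \1_[set y | (k.+1%:R / m.+1%:R) <= g y] x.
have bgm m : bounded_mfun (gm m).
  apply: bounded_mfunZ; apply: bounded_mfun_sum => k; exact: blev.
have gmP m x : `|g x - gm m x| <= m.+1%:R^-1.
  have m0 : 0 < m.+1%:R :> R by rewrite ltr0n.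
  have /andP[g0 g1] := g01 x.
  have y0 : 0 <= m.+1%:R * g x by rewrite mulr_ge0// ltW.
  have /andP[t1 t2] := Num.Theory.truncn_itv y0.
  have tm : (Num.truncn (m.+1%:R * g x) <= m.+1)%N.
    rewrite -(ler_nat R) (le_trans t1)// ler_piMr// ltW//.
  have -> : gm m x = m.+1%:R^-1 * (Num.truncn (m.+1%:R * g x))%:R.
    rewrite /gm; congr (_ * _).
    rewrite (eq_bigr (fun k : 'I_m.+1 =>
        if (k < Num.truncn (m.+1%:R * g x))%N then 1 else 0)).
      by rewrite -big_mkcond /= -(big_ord_widen _ (fun=> 1) tm) sumr_const card_ord.
    move=> k _; rewrite indicE -[RHS](@mulrb R).
    congr ((nat_of_bool _)%:R).
    apply/idP/idP => [|hk].
      by rewrite inE /= ler_pdivrMr// mulrC => hk; rewrite Num.Theory.truncn_ge_nat.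
    by rewrite inE /= ler_pdivrMr// mulrC (le_trans _ t1)// ler_nat.
  have -> : g x - m.+1%:R^-1 * (Num.truncn (m.+1%:R * g x))%:R =
     m.+1%:R^-1 * (m.+1%:R * g x - (Num.truncn (m.+1%:R * g x))%:R).
    by rewrite mulrBr mulKf// gt_eqF.
  rewrite normrM gtr0_norm ?invr_gt0// ler_piMr ?invr_ge0//.
  by rewrite ger0_norm ?subr_ge0// lerBlDl natr1 ltW.
have gmE m : 'E (fun x => gm m x * H x) = 'E (gm m) * c.
  rewrite (_ : (fun x => _) = (fun x => m.+1%:R^-1 *
     (\sum_(k < m.+1) \1_[set y | (k.+1%:R / m.+1%:R) <= g y] x * H x))); last first.
    by apply/funext => x; rewrite /gm -mulrA mulr_suml.
  rewrite meanZ; last by apply: bounded_mfun_sum => k; apply: bounded_mfunM.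
  rewrite mean_sum; last by move=> k; apply: bounded_mfunM.
  rewrite meanZ; last by apply: bounded_mfun_sum.
  by rewrite mean_sum// -mulrA mulr_suml; congr (_ * _); apply: eq_bigr => k _.
have diff m : `|'E (fun x => g x * H x) - 'E g * c| <= (B + `|c|) / m.+1%:R.
  have -> : 'E (fun x => g x * H x) - 'E g * c =
     'E (fun x => (g x - gm m x) * H x) - 'E (fun x => g x - gm m x) * c.
    have -> : 'E (fun x => g x - gm m x) = 'E g - 'E (gm m) by exact: meanB.
    have -> : (fun x => (g x - gm m x) * H x) = (fun x => g x * H x - gm m x * H x).
      by apply/funext => x; rewrite mulrBl.
    have -> : 'E (fun x => g x * H x - gm m x * H x) =
        'E (fun x => g x * H x) - 'E (fun x => gm m x * H x).
      by apply: meanB; exact: bounded_mfunM.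
    by rewrite gmE; ring.
  rewrite mulrDl (le_trans (ler_normB _ _))// lerD//.
    apply: le_norm_mean; first by apply: bounded_mfunM => //; exact: bounded_mfunB.
    by move=> x; rewrite normrM mulrC ler_pM.
  rewrite normrM mulrC ler_wpM2l//.
  by apply: le_norm_mean => //; exact: bounded_mfunB.
apply/eqP; rewrite -subr_eq0 -normr_eq0 eq_le normr_ge0 andbT leNgt.
apply/negP => x0.
have := diff (Num.truncn ((B + `|c|) / `|'E (fun x => g x * H x) - 'E g * c|)).
rewrite leNgt => /negP; apply.
rewrite ltr_pdivrMr ?ltr0n// mulrC -ltr_pdivrMr//.
have q0 := divr_ge0 (addr_ge0 B0 (normr_ge0 c))
  (normr_ge0 ('E (fun x => g x * H x) - 'E g * c)).
by have /andP[_] := Num.Theory.truncn_itv q0.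
Qed.

(** Affine rescaling to [0, 1]; the level set below the lower bound of [g] is
   everything, which identifies [c] as the mean of [H]. *)
Lemma mean_mul_of_level_sets (g H : T -> R) (c : R) :
  bounded_mfun g -> bounded_mfun H ->
  (forall t, 'E (fun x => \1_[set y | t <= g y] x * H x) =
     'E (\1_[set y | t <= g y] : T -> R) * c) ->
  'E (fun x => g x * H x) = 'E g * c.
Proof.
move=> bg bH h; have [mg [B gB]] := bg.
have B0 : 0 <= B by apply: le_trans (gB point).
pose b := B + 1; have b0 : 0 < b by rewrite ltr_wpDl.
pose g1 x : R := (2 * b)^-1 * (g x + b).
have bg1 : bounded_mfun g1.
  by apply: bounded_mfunZ; apply: bounded_mfunD => //; exact: bounded_mfun_cst.
have gE x : g x = 2 * b * g1 x - b.
  by rewrite /g1 mulrA mulfV ?mul1r ?addrK// mulf_neq0// gt_eqF.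
have h1 := @mean_mul_of_level_sets01 g1 H c bg1 bH.
have lev t : [set y | t <= g1 y] = [set y | 2 * b * t - b <= g y].
  apply/seteqP; split=> y /=; rewrite gE lerD2r ler_pM2l//; exact: mulr_gt0.
have cE : 'E H = c.
  have := h (- B).
  rewrite (_ : [set y | - B <= g y] = setT).
    have -> : (\1_setT : T -> R) = fun=> 1 by apply/funext => x; rewrite indicT.
    by rewrite mean_cst mul1r => <-; congr Rintegral; apply/funext => x; rewrite mul1r.
  by apply/seteqP; split=> // y _ /=; have := gB y; rewrite ler_norml => /andP[].
have -> : (fun x => g x * H x) = (fun x => 2 * b * (g1 x * H x) - b * H x).
  by apply/funext => x; rewrite gE; ring.
have -> : g = (fun x => 2 * b * g1 x - b) by apply/funext => x.
have bgH := bounded_mfunM bg1 bH.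
rewrite (meanB (bounded_mfunZ (2 * b) bgH) (bounded_mfunZ b bH)).
rewrite (meanB (bounded_mfunZ (2 * b) bg1) (bounded_mfun_cst b)).
rewrite (meanZ _ bgH) (meanZ _ bH) (meanZ _ bg1) mean_cst cE h1.
- by ring.
- move=> x; have := gB x; rewrite ler_norml => /andP[l1 l2].
  rewrite /g1 mulr_ge0 ?invr_ge0 ?mulr_ge0 ?(ltW b0)//=; last by rewrite /b; lra.
  by rewrite ler_pdivrMl ?mulr_gt0//; rewrite /b; lra.
- by move=> t; rewrite lev.
Qed.


End Expectation.

(** * Products of independent variables and Chernoff bounds *)

Section Independence.
Context {R : realType} {disp : measure_display} {T : measurableType disp}.
Variable P : probability T R.
Local Notation "''E' f" := (Rintegral P setT f) (at level 10, f at level 9).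
Variables (I : finType) (F : I -> set (set T)) (g : I -> T -> R).
Hypothesis indepF : mutually_independent P F.
Hypothesis measF : forall i A, F i A -> measurable A.
Hypothesis bg : forall i, bounded_mfun (g i).
Hypothesis levF : forall i t, F i [set x | t <= g i x].

(** The functions are traded one at a time for indicators of events of the same
   class, until the independence of events applies. *)
Let mean_prod_indep_events (s : seq I) (J : {set I}) (A : I -> set T) :
  uniq s -> (forall i, i \in s -> i \notin J) -> (forall i, F i (A i)) ->
  'E (fun x => (\prod_(i <- s) g i x) * \prod_(i in J) \1_(A i) x) =
  (\prod_(i <- s) 'E (g i)) * \prod_(i in J) 'E (\1_(A i) : T -> R).
Proof.
have bA (B : I -> set T) (hB : forall i, F i (B i)) (K : {set I}) :
    bounded_mfun (fun x => \prod_(i in K) \1_(B i) x : R).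
  under [X in bounded_mfun X]funext do rewrite -big_enum.
  by apply: bounded_mfun_prod => i; apply: bounded_mfun_indic; exact: measF (hB i).
elim: s J A => [|i s ih] J A /=.
  move=> _ _ FA; rewrite big_nil mul1r.
  rewrite (_ : (fun x => _) = \1_(\big[setI/setT]_(i in J) A i)); last first.
    apply/funext => x; rewrite big_nil mul1r.
    elim/big_rec2 : _ => [|i y B _ ->]; first by rewrite indicT.
    by rewrite indicI.
  apply: (@EFin_inj R).
  rewrite mean_indic; last by apply: bigsetI_measurable => i _; exact: measF (FA i).
  rewrite indepF// (big_morph EFin EFinM erefl).
  by apply: eq_bigr => i _; rewrite -mean_indic//; exact: measF (FA i).
move=> /andP[si us] sJ FA.
rewrite (_ : (fun x => _) = (fun x => g i x *
  ((\prod_(i <- s) g i x) * \prod_(i in J) \1_(A i) x))); last first.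
  by apply/funext => x; rewrite big_cons mulrA.
have iJ : i \notin J by apply: sJ; rewrite mem_head.
have sJ' k : k \in s -> k \notin J by move=> ks; apply: sJ; rewrite inE ks orbT.
rewrite big_cons -mulrA; apply: mean_mul_of_level_sets => //.
  by apply: bounded_mfunM; [exact: bounded_mfun_prod|exact: bA].
move=> t.
pose A' k := if k == i then [set y | t <= g i y] else A k.
have FA' k : F k (A' k) by rewrite /A'; case: eqP => [->|_].
have := ih (i |: J) A' us _ FA'.
have -> : (fun x => (\prod_(k <- s) g k x) * \prod_(k in i |: J) \1_(A' k) x) =
   (fun x => \1_[set y | t <= g i y] x *
     ((\prod_(i <- s) g i x) * \prod_(i in J) \1_(A i) x)).
  apply/funext => x; rewrite big_setU1//= {1}/A' eqxx mulrCA; congr (_ * (_ * _)).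
  by apply: eq_bigr => k kJ; rewrite /A'; case: eqP => // ki; move: iJ; rewrite -ki kJ.
move=> ->; last first.
  move=> k ks; rewrite !inE negb_or sJ'// andbT.
  by apply: contraNneq si => <-.
rewrite big_setU1//= {1}/A' eqxx mulrCA; congr (_ * (_ * _)).
by apply: eq_bigr => k kJ; rewrite /A'; case: eqP => // ki; move: iJ; rewrite -ki kJ.
Qed.

Lemma mean_prod_indep (s : seq I) : uniq s ->
  'E (fun x => \prod_(i <- s) g i x) = \prod_(i <- s) 'E (g i).
Proof.
move=> us.
have := @mean_prod_indep_events s finset.set0 (fun i => [set x | 0 <= g i x]) us.
rewrite big_set0 mulr1 => <- //; last by move=> i _; rewrite inE.
by congr Rintegral; apply/funext => x; rewrite big_set0 mulr1.
Qed.

(** Each factor is affine in a product of two of the independent variables.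
   Expanding the factors one by one, their variables join the list [J], where
   [mean_prod_indep] applies. *)
Lemma mean_prod_blocks (K : Type) (i1 i2 : K -> I) (a b : K -> R)
    (s : seq K) (J : seq I) :
  uniq (flatten [seq [:: i1 k; i2 k] | k <- s] ++ J) ->
  'E (fun x => (\prod_(k <- s) (a k + b k * (g (i1 k) x * g (i2 k) x)))
        * \prod_(i <- J) g i x) =
  (\prod_(k <- s) (a k + b k * ('E (g (i1 k)) * 'E (g (i2 k)))))
    * \prod_(i <- J) 'E (g i).
Proof.
have bW (u : seq K) :
    bounded_mfun (fun x => \prod_(k <- u) (a k + b k * (g (i1 k) x * g (i2 k) x))).
  apply: bounded_mfun_prod => k; apply: bounded_mfunD; first exact: bounded_mfun_cst.
  by apply: bounded_mfunZ; exact: bounded_mfunM.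
elim: s J => [|k s ih] J uJ.
  rewrite big_nil mul1r -mean_prod_indep//.
  by congr Rintegral; apply/funext => x; rewrite big_nil mul1r.
set W := fun x => \prod_(k <- s) (a k + b k * (g (i1 k) x * g (i2 k) x)).
rewrite (_ : (fun x => _) = (fun x => a k * (W x * \prod_(i <- J) g i x)
   + b k * (W x * \prod_(i <- [:: i1 k, i2 k & J]) g i x))); last first.
  by apply/funext => x; rewrite !big_cons; rewrite -/(W x); ring.
have b1 J' : bounded_mfun (fun x => W x * \prod_(i <- J') g i x).
  by apply: bounded_mfunM; [exact: bW|exact: bounded_mfun_prod].
rewrite (meanD P (bounded_mfunZ (a k) (b1 J)) (bounded_mfunZ (b k) (b1 _))).
rewrite (meanZ P _ (b1 J)) (meanZ P _ (b1 _)) !ih.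
- by rewrite !big_cons; ring.
- have p : perm_eq (flatten [seq [:: i1 l; i2 l] | l <- s] ++ [:: i1 k; i2 k] ++ J)
      ([:: i1 k; i2 k] ++ flatten [seq [:: i1 l; i2 l] | l <- s] ++ J).
    by rewrite perm_catCA.
  by rewrite (perm_uniq p).
- by move: uJ => /= /and3P[].
Qed.

End Independence.

Section Tails.
Context {R : realType} {disp : measure_display} {T : measurableType disp}.
Variable P : probability T R.
Local Notation "''E' f" := (Rintegral P setT f) (at level 10, f at level 9).

Lemma expR_le_quadratic (x : R) : x <= 2^-1 -> expR x <= 1 + x + 2 * x ^+ 2.
Proof.
move=> xh; have x1 : 0 < 1 - x by lra.
have h : 1 - x <= (expR x)^-1 by rewrite -expRN; exact: expR_ge1Dx.
have : expR x <= (1 - x)^-1.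
  by rewrite -[expR x]invrK lef_pV2// posrE// invr_gt0 expR_gt0.
move=> /le_trans; apply; rewrite -[leLHS]mul1r ler_pdivrMr//.
have : 0 <= x ^+ 2 * (1 - 2 * x) by rewrite mulr_ge0 ?sqr_ge0//; lra.
have -> : (1 + x + 2 * x ^+ 2) * (1 - x) = 1 + x ^+ 2 * (1 - 2 * x) by ring.
lra.
Qed.

(** The quadratic bound on the exponential turns the first
   two moments into a bound on the moment generating function. *)
Lemma chernoff_tail (K : eqType) (s : seq K) (Z : K -> T -> R) (la v t : R) :
  (forall k, bounded_mfun (Z k)) -> (forall k x, k \in s -> `|Z k x| <= 1) ->
  0 <= la <= 2^-1 ->
  (forall k, k \in s -> 'E (Z k) <= 0) ->
  (forall k, k \in s -> 'E (fun x => Z k x ^+ 2) <= v) ->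
  'E (fun x => \prod_(k <- s) expR (la * Z k x)) =
    \prod_(k <- s) 'E (fun x => expR (la * Z k x)) ->
  measurable [set x | t <= \sum_(k <- s) Z k x] /\
  (P [set x | t <= \sum_(k <- s) Z k x]%R <=
     (expR (2 * la ^+ 2 * (size s)%:R * v - la * t))%:E)%E.
Proof.
move=> bZ Z1 /andP[la0 la2] Z0 Zv Eprod.
have bS := bounded_mfun_sum s xpredT bZ.
have mS : measurable [set x | t <= \sum_(k <- s) Z k x].
  rewrite -[X in measurable X]setTI; apply: measurable_fun_le => //.
  by case: bS.
have beZ k : bounded_mfun (fun x => expR (la * Z k x)).
  by apply: bounded_mfun_expR; exact: bounded_mfunZ.
split=> //; rewrite -mean_indic// lee_fin.
apply: (@le_trans _ _
  ('E (fun x => expR (- (la * t)) * \prod_(k <- s) expR (la * Z k x)))).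
  apply: mean_le.
  - exact: bounded_mfun_indic.
  - by apply: bounded_mfunZ; exact: bounded_mfun_prod.
  move=> x; rewrite -expR_sum -expRD -mulr_sumr -mulrN -mulrDr addrC.
  rewrite indicE; have [|_] := boolP (_ \in _); last by rewrite ltW// expR_gt0.
  rewrite inE /= => h; rewrite -expR0 ler_expR mulr_ge0//.
  by rewrite subr_ge0.
rewrite meanZ; last exact: bounded_mfun_prod.
rewrite Eprod mulrC expRD ler_wpM2r ?(ltW (expR_gt0 _))//.
have -> : expR (2 * la ^+ 2 * (size s)%:R * v) = \prod_(k <- s) expR (2 * la ^+ 2 * v).
  rewrite -expR_sum; congr expR; rewrite big_const_seq count_predT iter_addr_0.
  by rewrite -mulr_natr; ring.
rewrite big_seq [leRHS]big_seq.
apply: ler_prod => k ks; apply/andP; split.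
  by apply: Rintegral_ge0 => x _; rewrite ltW// expR_gt0.
apply: le_trans (expR_ge1Dx _).
have bZ2 : bounded_mfun (fun x => Z k x ^+ 2) by apply: bounded_mfunM.
apply: (@le_trans _ _ ('E (fun x => 1 + la * Z k x + 2 * la ^+ 2 * Z k x ^+ 2))).
  apply: mean_le => //.
    apply: bounded_mfunD; last exact: bounded_mfunZ.
    by apply: bounded_mfunD; [exact: bounded_mfun_cst|exact: bounded_mfunZ].
  move=> x; rewrite -mulrA -exprMn; apply: expR_le_quadratic.
  have := Z1 k x ks; rewrite ler_norml => /andP[_ zl].
  by rewrite (le_trans (ler_wpM2l la0 zl))// mulr1.
have b1Z := bounded_mfunD (bounded_mfun_cst 1) (bounded_mfunZ la (bZ k)).
rewrite (meanD P b1Z (bounded_mfunZ _ bZ2)).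
rewrite (meanD P (bounded_mfun_cst 1) (bounded_mfunZ la (bZ k))).
rewrite (meanZ P _ (bZ k)) (meanZ _ _ bZ2) mean_cst -addrA lerD2l.
have := mulr_ge0_le0 la0 (Z0 k ks).
have := ler_wpM2l (_ : 0 <= 2 * la ^+ 2) (Zv k ks).
rewrite mulr_ge0 ?sqr_ge0// => /(_ erefl); lra.
Qed.

(** The terms [Z k] are functions of disjoint pairs of independent variables.
   In all uses one variable of the pair is an indicator, so that the exponential
   of [Z k] is affine in a product of one function of each. *)
Lemma block_tail (I : finType) (F : I -> set (set T)) (g : I -> T -> R)
    (K : eqType) (i1 i2 : K -> I) (a b : K -> R) (s : seq K)
    (Z : K -> T -> R) (la v t : R) :
  mutually_independent P F -> (forall i A, F i A -> measurable A) ->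
  (forall i, bounded_mfun (g i)) -> (forall i r, F i [set x | r <= g i x]) ->
  uniq (flatten [seq [:: i1 k; i2 k] | k <- s]) ->
  (forall k x, expR (la * Z k x) = a k + b k * (g (i1 k) x * g (i2 k) x)) ->
  (forall k, bounded_mfun (Z k)) -> (forall k x, k \in s -> `|Z k x| <= 1) ->
  0 <= la <= 2^-1 ->
  (forall k, k \in s -> 'E (Z k) <= 0) ->
  (forall k, k \in s -> 'E (fun x => Z k x ^+ 2) <= v) ->
  measurable [set x | t <= \sum_(k <- s) Z k x] /\
  (P [set x | t <= \sum_(k <- s) Z k x]%R <=
     (expR (2 * la ^+ 2 * (size s)%:R * v - la * t))%:E)%E.
Proof.
move=> iF mF bg lF us eZ bZ Z1 hla Z0 Zv.
have key u : uniq (flatten [seq [:: i1 k; i2 k] | k <- u]) ->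
   'E (fun x => \prod_(k <- u) expR (la * Z k x)) =
   \prod_(k <- u) (a k + b k * ('E (g (i1 k)) * 'E (g (i2 k)))).
  move=> uu.
  have := mean_prod_blocks iF mF bg lF (i1 := i1) (i2 := i2) a b (s := u) (J := [::]).
  rewrite cats0 big_nil mulr1 => /(_ uu) <-.
  congr Rintegral; apply/funext => x; rewrite big_nil mulr1.
  by apply: eq_bigr => k _.
apply: chernoff_tail => //; rewrite key// big_seq [RHS]big_seq.
apply: eq_bigr => k ks.
have := key [:: k]; rewrite big_seq1 => <-.
  by congr Rintegral; apply/funext => x; rewrite big_seq1.
rewrite /=; move: us => /=.
move: ks; elim: (s) => // l s' ih; rewrite inE => /orP[/eqP <-|ks] /=.
  by rewrite !inE !negb_or => /andP[/andP[-> _] _].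
by move=> /and3P[_ _]; exact: ih.
Qed.

End Tails.

(** * The Haar measure on rotations *)

Section MatrixMeasurability.
Context {R : realType} {d : nat}.

Lemma measurable_mx_entry (i j : 'I_d) :
  measurable_fun setT (fun A : borel_mx R d => A i j : R).
Proof.
apply: (measurability _ (RGenOpens.measurableE R)) => _ [_ [a [b ->]] <-].
rewrite setTI; apply: sub_gen_smallest.
apply: (@open_comp 'M[R]_d R (fun A => A i j)); last exact: interval_open.
by move=> A _; exact: coord_continuous.
Qed.

Lemma continuous_mulmxl (Q : 'M[R]_d) : continuous (mulmx Q : 'M[R]_d -> 'M[R]_d).
Proof.
move=> A B [V hV hB].
have h i j : \forall C \near A, V i j ((Q *m C) i j).
  have c : continuous (fun C : 'M[R]_d => \sum_k Q i k * C k j).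
    apply: continuous_big => [|k _ C]; first exact: add_continuous.
    by apply: cvgMl_tmp; [exact: (nbhs_filter C)|exact: (@coord_continuous R d d k j C)].
  have E C : (Q *m C) i j = \sum_k Q i k * C k j by rewrite mxE.
  have /(c A) : nbhs (\sum_k Q i k * A k j) (V i j) by rewrite -E; exact: hV.
  by move=> h; apply: (@filterS _ _ (nbhs_filter A) _ _ _ h) => C /=; rewrite E.
have FA := nbhs_filter A.
have H := @filter_forall _ _ _ _ FA (fun i => @filter_forall _ _ _ _ FA (h i)).
by apply: (@filterS _ _ FA _ _ _ H) => C hC; exact: hB.
Qed.

Lemma measurable_mulmxl (Q : 'M[R]_d) :
  measurable_fun setT (mulmx Q : borel_mx R d -> borel_mx R d).
Proof.
apply: (@measurability _ _ (borel_mx R d) (borel_mx R d) setT (mulmx Q)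
  (@open 'M[R]_d)) => // _ [U oU <-].
rewrite setTI; apply: sub_gen_smallest.
by apply: open_comp => // A _; exact: continuous_mulmxl.
Qed.

Context {disp : measure_display} {T : measurableType disp}.

(** Measurability of the entries.  It follows from Borel measurability, it is
   stable under products of matrix-valued maps, also on product spaces, and it
   suffices for all real functions of matrices that occur. *)
Definition mx_measurable (V : T -> 'M[R]_d) :=
  forall i j, measurable_fun setT (fun x => V x i j).

Lemma mx_measurable_cst A : mx_measurable (fun=> A).
Proof. by move=> i j; exact: measurable_cst. Qed.

Lemma mx_measurable_tr V : mx_measurable V -> mx_measurable (fun x => (V x)^T).
Proof.
by move=> h i j; under [X in measurable_fun _ X]funext do rewrite mxE; exact: h.
Qed.

Lemma mx_measurable_mul V W : mx_measurable V -> mx_measurable W ->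
  mx_measurable (fun x => V x *m W x).
Proof.
move=> hV hW i j; under [X in measurable_fun _ X]funext do rewrite mxE.
by apply: measurable_sum => k; exact: measurable_funM.
Qed.

Lemma mx_measurable_borel (X : T -> borel_mx R d) : measurable_fun setT X ->
  mx_measurable X.
Proof. move=> mX i j; exact: measurableT_comp (measurable_mx_entry i j) mX. Qed.

Lemma mx_measurable_SO (V : T -> 'M[R]_d) : mx_measurable V ->
  measurable [set x | SO R d (V x)].
Proof.
move=> hV.
have m1 (h : T -> R) c : measurable_fun setT h -> measurable [set x | h x = c].
  move=> mh; rewrite -[X in measurable X]setTI.
  exact: (mh measurableT [set c]).
have -> : [set x | SO R d (V x)] =
   (\big[setI/setT]_(i < d) \big[setI/setT]_(j < d)
      [set x | ((V x)^T *m V x) i j = (1%:M : 'M[R]_d) i j]) `&`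
   [set x | \det (V x) = 1].
  apply/seteqP; split => x /= [h1 h2]; split=> //.
    rewrite -bigcap_seq => i _; rewrite -bigcap_seq => j _ /=.
    by rewrite h1.
  apply/matrixP => i j.
  move: h1; rewrite -bigcap_seq => /(_ i); rewrite -bigcap_seq => /(_ _ j).
  by apply; rewrite /= mem_index_enum.
apply: measurableI.
  apply: bigsetI_measurable => i _; apply: bigsetI_measurable => j _.
  apply: m1; exact: (mx_measurable_mul (mx_measurable_tr hV) hV).
apply: m1; apply: measurable_sum => s; apply: measurable_funM => //.
by apply: measurable_prod => i _.
Qed.

End MatrixMeasurability.

Section SkewDirection.
Context {R : realType} {d : nat}.

(** The skew part of the subgradient, at the identity, of the distance to [V]. *)
Definition skew_dir (V : 'M[R]_d) (x y : 'I_d) : R :=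
  ((1%:M - V) x y - (1%:M - V) y x) / (2 * frob (1%:M - V)).

Lemma skew_dir_tr V x y : skew_dir V^T x y = - skew_dir V x y.
Proof.
rewrite /skew_dir -mulNr; congr (_ / (2 * _)).
  by rewrite !mxE (eq_sym y x); ring.
by rewrite -[RHS]frob_tr linearB /= trmx1.
Qed.

Lemma skew_dir_le1 V x y : `|skew_dir V x y| <= 1.
Proof.
rewrite /skew_dir; set A := 1%:M - V.
have [->|A0] := eqVneq (frob A) 0; first by rewrite mulr0 invr0 mulr0 normr0.
have Ap : 0 < frob A by rewrite lt0r A0 frob_ge0.
rewrite normrM normfV [X in _ / X]gtr0_norm ?mulr_gt0// ler_pdivrMr ?mulr_gt0// mul1r.
rewrite (le_trans (ler_normB _ _))// mulr_natl mulr2n.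
by rewrite lerD// frob_entry_le.
Qed.

Lemma bounded_skew_dir (disp : measure_display) (T : measurableType disp)
    (V : T -> 'M[R]_d) x y : mx_measurable V ->
  bounded_mfun (fun w => skew_dir (V w) x y).
Proof.
move=> hV; split; last by exists 1 => w; exact: skew_dir_le1.
have e i j : measurable_fun setT (fun w => (1%:M - V w) i j).
  under [X in measurable_fun _ X]funext do rewrite !mxE.
  by apply: measurable_funB => //; exact: measurable_cst.
rewrite /skew_dir; apply: measurable_funM; first exact: measurable_funB.
have -> : (fun w => (2 * frob (1%:M - V w))^-1) =
  (fun w => 2^-1 * (\sum_i \sum_j (1%:M - V w) i j ^+ 2) `^ (- 2^-1)).
  apply/funext => w; rewrite invfM powRN powR12_sqrt//.
  by do 2!apply: sumr_ge0 => ? _; rewrite sqr_ge0.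
apply: measurable_funM; first exact: measurable_cst.
apply: (measurableT_comp (measurable_powR (- 2^-1))).
by apply: measurable_sum => i; apply: measurable_sum => j; exact: measurable_funX.
Qed.

End SkewDirection.

Section Haar.
Context {R : realType} {d : nat}.
Variable mu : probability (borel_mx R d) R.
Hypothesis haar : is_haar_SO mu.

Lemma haar_invariant (Q : 'M[R]_d) (f : borel_mx R d -> R) : SO R d Q ->
  bounded_mfun f -> Rintegral mu setT (fun A => f (Q *m A)) = Rintegral mu setT f.
Proof.
move=> hQ bf; have [mf [B fB]] := bf.
have mQ := measurable_mulmxl Q.
have bfQ : bounded_mfun (fun A : borel_mx R d => f (Q *m A)).
  by split; [exact: measurableT_comp mf mQ|exists B].
rewrite /Rintegral; congr fine.
have := @integral_pushforward _ _ _ _ R _ mQ mu setT (EFin \o f).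
rewrite preimage_setT => <- //; first last.
  - exact: bounded_mfun_integrable.
  - exact/measurable_EFinP.
apply: eq_measure_integral => A mA _.
by have [_ /(_ Q A hQ mA)] := haar.
Qed.

Lemma haar_SO_null : mu (~` SO R d) = 0%E.
Proof.
have mSO : measurable (SO R d : set (borel_mx R d)).
  by apply: (@mx_measurable_SO R d _ (borel_mx R d) id) => i j; exact: measurable_mx_entry.
have := probability_setC mu mSO.
by rewrite (haar.1) subee.
Qed.

Lemma eq_mean_on_SO (f g : borel_mx R d -> R) : bounded_mfun f -> bounded_mfun g ->
  (forall A, SO R d A -> f A = g A) -> Rintegral mu setT f = Rintegral mu setT g.
Proof.
move=> [mf _] [mg _] fg; congr fine; apply: ae_eq_integral => //.
- exact/measurable_EFinP.
- exact/measurable_EFinP.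
exists (~` SO R d); split.
- rewrite -[SO R d]/[set x | SO R d (id x)]; apply: measurableC.
  by apply: (@mx_measurable_SO R d _ (borel_mx R d) id) => i j; exact: measurable_mx_entry.
- exact: haar_SO_null.
- by move=> A /= h hA; apply: h => _; rewrite fg.
Qed.

(** Inversion of a rotation changes the sign of [skew_dir], so it suffices that
   the Haar measure is invariant under inversion and right translation.  Both
   follow from left invariance by integrating [f (B^T *m A *m c)] over [A] and
   [B]: integrating first over [A] removes [B], integrating first over [B], after
   an inversion, removes [A *m c]. *)
Lemma haar_skew_mean (a b : 'M[R]_d) x y : SO R d a -> SO R d b ->
  Rintegral mu setT (fun A => skew_dir (a *m A *m b) x y) = 0.
Proof.
move=> ha hb; pose f (A : borel_mx R d) : R := skew_dir A x y.
have mid : mx_measurable (id : borel_mx R d -> 'M[R]_d).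
  by move=> i j; exact: measurable_mx_entry.
have bf : bounded_mfun f by exact: bounded_skew_dir.
have bfr c : bounded_mfun (fun A : borel_mx R d => f (A *m c)).
  by apply: bounded_skew_dir; apply: mx_measurable_mul => //; exact: mx_measurable_cst.
have key c : SO R d c ->
    Rintegral mu setT (fun A => f (A *m c)) = - Rintegral mu setT f.
  move=> hc.
  pose G (z : borel_mx R d * borel_mx R d) : R := skew_dir (z.2^T *m (z.1 *m c)) x y.
  have mfst : mx_measurable (fun z : borel_mx R d * borel_mx R d => z.1).
    by apply: mx_measurable_borel; exact: measurable_fst.
  have msnd : mx_measurable (fun z : borel_mx R d * borel_mx R d => z.2).
    by apply: mx_measurable_borel; exact: measurable_snd.
  have bG : bounded_mfun G.
    apply: bounded_skew_dir; apply: mx_measurable_mul; first exact: mx_measurable_tr.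
    by apply: mx_measurable_mul => //; exact: mx_measurable_cst.
  have inner1 A : SO R d A -> Rintegral mu setT (fun B => G (A, B)) = - Rintegral mu setT f.
    move=> hA.
    have hQ : SO R d (A *m c)^T by apply: SO_tr; exact: SO_mul.
    rewrite -mulN1r -(haar_invariant hQ bf) -meanZ.
      congr Rintegral; apply/funext => B; rewrite mulN1r /G /f /=.
      by rewrite -skew_dir_tr trmx_mul trmxK.
    split; last by exists 1 => B; exact: skew_dir_le1.
    exact: measurableT_comp bf.1 (measurable_mulmxl _).
  have inner2 B : SO R d B ->
      Rintegral mu setT (fun A => G (A, B)) = Rintegral mu setT (fun A => f (A *m c)).
    move=> hB; rewrite -(haar_invariant (SO_tr hB) (bfr c)).
    by congr Rintegral; apply/funext => A; rewrite /G /f /= mulmxA.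
  (* The translations are by elements of SO(d) only almost surely; cutting off
     by indicators makes the partial integrals known at every point. *)
  pose ind A : R := \1_(SO R d) A.
  pose H (z : borel_mx R d * borel_mx R d) : R := (ind z.1 * ind z.2) * G z.
  have bind : bounded_mfun (ind : borel_mx R d -> R).
    by apply: bounded_mfun_indic; exact: (mx_measurable_SO mid).
  have bH : bounded_mfun H.
    apply: bounded_mfunM => //; apply: bounded_mfunM.
      have [_ [B hB]] := bind; split; last by exists B.
      exact: measurableT_comp bind.1 measurable_fst.
    have [_ [B hB]] := bind; split; last by exists B.
    exact: measurableT_comp bind.1 measurable_snd.
  have iH : (mu \x mu)%E.-integrable setT (EFin \o H).
    exact: (@bounded_mfun_integrable _ _ _ (mu \x mu)%E _ bH).
  have indT A : SO R d A -> ind A = 1 by move=> hA; rewrite /ind indicE mem_set.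
  have indF A : ~ SO R d A -> ind A = 0 by move=> hA; rewrite /ind indicE memNset.
  have Eind : Rintegral mu setT ind = 1.
    by apply: (@EFin_inj R); rewrite mean_indic ?haar.1//; exact: (mx_measurable_SO mid).
  have sliceE (h k : borel_mx R d -> R) c0 :
      bounded_mfun h -> bounded_mfun k -> (forall A, SO R d A -> h A = k A) ->
      Rintegral mu setT k = c0 -> (\int[mu]_A (h A)%:E)%E = c0%:E.
    move=> bh bk hk <-; rewrite -(eq_mean_on_SO bh bk hk) /Rintegral fineK//.
    by apply: integrable_fin_num => //; exact: bounded_mfun_integrable.
  have bG1 A : bounded_mfun (fun B => G (A, B)).
    by split; [exact: measurable_fun_pair2 bG.1|exists 1 => B; exact: skew_dir_le1].
  have bG2 B : bounded_mfun (fun A => G (A, B)).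
    by split; [exact: measurable_fun_pair1 bG.1|exists 1 => A; exact: skew_dir_le1].
  have e1 : (\int[mu]_A \int[mu]_B (EFin \o H) (A, B))%E = (- Rintegral mu setT f)%:E.
    transitivity (\int[mu]_A (ind A * - Rintegral mu setT f)%:E)%E.
      apply: eq_integral => A _ /=; apply: (sliceE _ (fun B => ind A * G (A, B))).
      - exact: (bounded_mfunM (bounded_mfunZ (ind A) bind) (bG1 A)).
      - exact: (bounded_mfunZ (ind A) (bG1 A)).
      - by move=> B hB; rewrite /H /= (indT B)// mulr1.
      - rewrite (meanZ mu (ind A) (bG1 A)).
        have [hA|hA] := pselect (SO R d A); first by rewrite inner1.
        rewrite (indF A hA); exact: etrans (mul0r _) (esym (mul0r _)).
    apply: (sliceE _ (fun A => ind A * - Rintegral mu setT f)) => //.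
    - by apply: bounded_mfunM => //; exact: bounded_mfun_cst.
    - by apply: bounded_mfunM => //; exact: bounded_mfun_cst.
    - have -> : (fun A => ind A * (- Rintegral mu setT f)) =
          (fun A => (- Rintegral mu setT f) * ind A).
        by apply/funext => A; rewrite mulrC.
      by rewrite (meanZ mu _ bind) Eind mulr1.
  have e2 : (\int[mu]_B \int[mu]_A (EFin \o H) (A, B))%E =
      (Rintegral mu setT (fun A => f (A *m c)))%:E.
    transitivity (\int[mu]_B (ind B * Rintegral mu setT (fun A => f (A *m c)))%:E)%E.
      apply: eq_integral => B _ /=; apply: (sliceE _ (fun A => ind B * G (A, B))).
      - exact: (bounded_mfunM (bounded_mfunM bind (bounded_mfun_cst (ind B))) (bG2 B)).
      - exact: (bounded_mfunZ (ind B) (bG2 B)).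
      - by move=> A hA; rewrite /H /= (indT A)// mul1r.
      - rewrite (meanZ mu (ind B) (bG2 B)).
        have [hB|hB] := pselect (SO R d B); first by rewrite inner2.
        rewrite (indF B hB); exact: etrans (mul0r _) (esym (mul0r _)).
    apply: (sliceE _ (fun B => ind B * Rintegral mu setT (fun A => f (A *m c)))) => //.
    - by apply: bounded_mfunM => //; exact: bounded_mfun_cst.
    - by apply: bounded_mfunM => //; exact: bounded_mfun_cst.
    - have -> : (fun A => ind A * Rintegral mu setT (fun A => f (A *m c))) =
          (fun A => Rintegral mu setT (fun A => f (A *m c)) * ind A).
        by apply/funext => A; rewrite mulrC.
      by rewrite (meanZ mu _ bind) Eind mulr1.
  apply: (@EFin_inj R); exact: (etrans (esym e2) (etrans (esym (Fubini iH)) e1)).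
have h1 : SO R d 1%:M by split; rewrite ?trmx1 ?mul1mx ?det1.
have f0 : Rintegral mu setT f = 0.
  have e : (fun A : borel_mx R d => f (A *m 1%:M)) = f.
    by apply/funext => A; rewrite mulmx1.
  by have := key _ h1; rewrite e; lra.
have h2 : Rintegral mu setT (fun A => f (A *m b)) = 0.
  by rewrite (key b hb) f0 oppr0.
exact: (etrans (haar_invariant ha (bfr b)) h2).
Qed.

End Haar.

(** * Independent variables of the corruption model *)

Definition inlier (s : edge_status) : bool := if s is Inlier then true else false.
Definition outlier (s : edge_status) : bool := if s is Outlier then true else false.

Section Model.
Context {R : realType} {d n : nat} {p q : R} {disp : measure_display}
  {Omega : measurableType disp} {P : probability Omega R}.
Variable M : rcm d n p q P.
Local Notation "''E' f" := (Rintegral P setT f) (at level 10, f at level 9).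

Definition edge_st (e : upper_pair n) : Omega -> edge_status :=
  rcm_status M (val e).1 (val e).2.

Definition edge_noise (e : upper_pair n) : Omega -> borel_mx R d :=
  rcm_noise M (val e).1 (val e).2.

Definition rcm_events (k : upper_pair n + upper_pair n) : set (set Omega) :=
  match k with
  | inl e => preimage_set_system setT
               (rcm_status M (val e).1 (val e).2) setT
  | inr e => preimage_set_system setT
               (rcm_noise M (val e).1 (val e).2) measurable
  end.

Lemma rcm_events_indep : mutually_independent P rcm_events.
Proof. exact: (@rcm_indep _ _ _ _ _ _ _ _ M). Qed.

Lemma measurable_edge_st e (S : set edge_status) : measurable (edge_st e @^-1` S).
Proof.
have m s : measurable [set w | edge_st e w = s /\ S s].
  have [hS|hS] := pselect (S s).
    rewrite (_ : [set w | _] = edge_st e @^-1` [set s]).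
      exact: rcm_status_measurable (valP e).
    by apply/seteqP; split => w /=; [case|].
  by rewrite (_ : [set w | _] = set0)//; apply/seteqP; split => w //= [].
rewrite (_ : _ @^-1` _ = [set w | edge_st e w = Inlier /\ S Inlier] `|`
   [set w | edge_st e w = Outlier /\ S Outlier] `|`
   [set w | edge_st e w = Missing /\ S Missing]).
  by apply: measurableU; [apply: measurableU|]; exact: m.
apply/seteqP; split => w /=.
  by case: (edge_st e w) => h; [left; left|left; right|right].
by case=> [[|]|] [-> ].
Qed.

Lemma measurable_edge_noise e : measurable_fun setT (edge_noise e).
Proof. exact: measurable_funP. Qed.

Lemma rcm_events_measurable k A : rcm_events k A -> measurable A.
Proof.
case: k => e /= [B mB <-].
  by rewrite setTI; exact: measurable_edge_st.
exact: (measurable_edge_noise e measurableT mB).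
Qed.

(** The variables that are measurable for one of the classes [rcm_events]. *)
Definition rcm_fun (phi : upper_pair n -> edge_status -> R)
    (psi : upper_pair n -> borel_mx R d -> R)
    (k : upper_pair n + upper_pair n) (w : Omega) : R :=
  match k with
  | inl e => phi e (edge_st e w)
  | inr e => psi e (edge_noise e w)
  end.

Lemma rcm_fun_bounded phi psi k : (forall e, bounded_mfun (psi e)) ->
  bounded_mfun (rcm_fun phi psi k).
Proof.
move=> bpsi; case: k => e; last first.
  have [mpsi [B hB]] := bpsi e; split; last by exists B => w; exact: hB.
  exact: measurableT_comp mpsi (measurable_edge_noise e).
split.
  move=> _ B _; rewrite setTI.
  exact: (measurable_edge_st e (phi e @^-1` B)).
exists (`|phi e Inlier| + `|phi e Outlier| + `|phi e Missing|) => w /=.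
have h0 (s : edge_status) := normr_ge0 (phi e s).
have := h0 Inlier; have := h0 Outlier; have := h0 Missing.
by case: (edge_st e w); lra.
Qed.

Lemma rcm_fun_levels phi psi k t : (forall e, bounded_mfun (psi e)) ->
  rcm_events k [set w | t <= rcm_fun phi psi k w].
Proof.
move=> bpsi; case: k => e /=.
  exists [set s | t <= phi e s] => //.
  by rewrite setTI.
exists [set V | t <= psi e V]; last by rewrite setTI.
rewrite -[X in measurable X]setTI; apply: measurable_fun_le => //.
by have [] := bpsi e.
Qed.

Lemma mean_inlier e :
  'E (fun w => (inlier (edge_st e w))%:R) = p * q.
Proof.
apply: (@EFin_inj R); rewrite -(rcm_inlier M (valP e)) -mean_indic.
  congr ((Rintegral _ _ _)%:E); apply/funext => w; rewrite indicE.
  rewrite /edge_st; case h: (rcm_status _ _ _ _).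
  - by rewrite mem_set.
  - by rewrite memNset//= h.
  - by rewrite memNset//= h.
exact: rcm_status_measurable (valP e).
Qed.

Lemma mean_outlier e :
  'E (fun w => (outlier (edge_st e w))%:R) = (1 - p) * q.
Proof.
apply: (@EFin_inj R); rewrite -(rcm_outlier M (valP e)) -mean_indic.
  congr ((Rintegral _ _ _)%:E); apply/funext => w; rewrite indicE.
  rewrite /edge_st; case h: (rcm_status _ _ _ _).
  - by rewrite memNset//= h.
  - by rewrite mem_set.
  - by rewrite memNset//= h.
exact: rcm_status_measurable (valP e).
Qed.

Lemma mean_edge_noise e (psi : borel_mx R d -> R) : bounded_mfun psi ->
  'E (fun w => psi (edge_noise e w)) =
  Rintegral (distribution P (rcm_noise M (val e).1 (val e).2)) setT psi.
Proof.
move=> bpsi; have [mpsi [B hB]] := bpsi.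
rewrite /Rintegral; congr fine.
rewrite (@integral_distribution _ _ _ _ _ P
  (rcm_noise M (val e).1 (val e).2) (EFin \o psi))//.
  exact/measurable_EFinP.
apply: bounded_mfun_integrable; split; last by exists B => w; exact: hB.
exact: measurableT_comp mpsi (measurable_edge_noise e).
Qed.

Lemma uniq_flatten_pairs (K I : eqType) (i1 i2 : K -> I) (s : seq K) :
  uniq s -> {in s &, injective i1} -> {in s &, injective i2} ->
  (forall k l, k \in s -> l \in s -> i1 k != i2 l) ->
  uniq (flatten [seq [:: i1 k; i2 k] | k <- s]).
Proof.
elim: s => //= k s ih /andP[ks us] inj1 inj2 dis.
have sub l : l \in s -> l \in k :: s by move=> ls; rewrite inE ls orbT.
have kin : k \in k :: s by rewrite mem_head.
rewrite ih//; first last.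
- by move=> l m ls ms; apply: dis; exact: sub.
- by move=> l m ls ms; apply: inj2; exact: sub.
- by move=> l m ls ms; apply: inj1; exact: sub.
have nin i : (forall l, l \in s -> i != i1 l) -> (forall l, l \in s -> i != i2 l) ->
    i \notin flatten [seq [:: i1 k; i2 k] | k <- s].
  move=> h1 h2; apply/flattenP => -[_ /mapP[l ls ->]]; rewrite !inE.
  by rewrite (negbTE (h1 l ls)) (negbTE (h2 l ls)).
rewrite inE negb_or dis//= andbT nin ?nin//.
- by move=> l ls; rewrite eq_sym dis// sub.
- move=> l ls; apply: contraNneq ks => /inj2 -> //; exact: sub.
- move=> l ls; apply: contraNneq ks => /inj1 -> //; exact: sub.
- by move=> l ls; rewrite dis// sub.
Qed.

(** Used both for degrees, with [psi] constant and [pi] the probability of [B],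
   and for the row sums of skew directions, with [pi = 0].  The exponential of a
   term is [expR (- la * pi) * (1 + 1_B * (expR (la * psi) - 1))]. *)
Lemma edge_sum_tail (K : eqType) (s : seq K) (ed : K -> upper_pair n)
    (B : edge_status -> bool) (psi : upper_pair n -> borel_mx R d -> R)
    (pi la t : R) :
  uniq s -> {in s &, injective ed} ->
  (forall e, bounded_mfun (psi e)) ->
  (forall k w, k \in s ->
     `|(B (edge_st (ed k) w))%:R * psi (ed k) (edge_noise (ed k) w) - pi| <= 1) ->
  (forall k, k \in s -> 'E (fun w => (B (edge_st (ed k) w))%:R) *
     'E (fun w => psi (ed k) (edge_noise (ed k) w)) = pi) ->
  0 <= la <= 2^-1 ->
  measurable [set w | t <= \sum_(k <- s)
      ((B (edge_st (ed k) w))%:R * psi (ed k) (edge_noise (ed k) w) - pi)] /\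
  (P [set w | t <= \sum_(k <- s)
      ((B (edge_st (ed k) w))%:R * psi (ed k) (edge_noise (ed k) w) - pi)]%R
   <= (expR (2 * la ^+ 2 * (size s)%:R * 1 - la * t))%:E)%E.
Proof.
move=> us inje bpsi Z1 Epi hla.
pose phi (e : upper_pair n) s : R := (B s)%:R.
have bexp e : bounded_mfun (fun V => expR (la * psi e V) - 1).
  apply: bounded_mfunB; last exact: bounded_mfun_cst.
  by apply: bounded_mfun_expR; exact: bounded_mfunZ.
pose g := rcm_fun phi (fun e V => expR (la * psi e V) - 1).
have uf : uniq (flatten
    [seq [:: inl (ed k); inr (ed k) : upper_pair n + upper_pair n] | k <- s]).
  apply: uniq_flatten_pairs => //.
  - by move=> k l ks ls [] /inje; exact.
  - by move=> k l ks ls [] /inje; exact.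
have bf psi' := rcm_fun_bounded phi (psi := psi').
have bZ k : bounded_mfun (fun w =>
    (B (edge_st (ed k) w))%:R * psi (ed k) (edge_noise (ed k) w) - pi).
  apply: bounded_mfunB; last exact: bounded_mfun_cst.
  by apply: bounded_mfunM; [exact: (bf psi (inl (ed k)))|exact: (bf psi (inr (ed k)))].
apply: (block_tail (F := rcm_events) (g := g) (i1 := fun k => inl (ed k))
  (i2 := fun k => inr (ed k)) (a := fun=> expR (- (la * pi)))
  (b := fun=> expR (- (la * pi)))) => //.
- exact: rcm_events_indep.
- exact: rcm_events_measurable.
- by move=> i; exact: rcm_fun_bounded.
- by move=> i r; exact: rcm_fun_levels.
- move=> k w; rewrite /g /rcm_fun /phi mulrBr addrC expRD.
  case: (B _); last by rewrite !mul0r !mulr0 expR0; ring.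
  by rewrite !mul1r; ring.
- move=> k ks.
  have bBpsi := bounded_mfunM (bf psi (inl (ed k)) bpsi) (bf psi (inr (ed k)) bpsi).
  rewrite (meanB P bBpsi (bounded_mfun_cst pi)).
  rewrite mean_cst subr_le0.
  have := mean_prod_indep rcm_events_indep rcm_events_measurable
    (fun i => rcm_fun_bounded phi i bpsi) (fun i t => rcm_fun_levels phi i t bpsi)
    (s := [:: inl (ed k); inr (ed k)]) erefl.
  rewrite big_cons big_seq1 /= (Epi k ks) => <-.
  rewrite le_eqVlt; apply/orP; left; apply/eqP; congr Rintegral.
  by apply/funext => w; rewrite big_cons big_seq1.
- move=> k ks; rewrite -[leRHS](mean_cst P).
  apply: mean_le; [by apply: bounded_mfunM|exact: bounded_mfun_cst|].
  move=> w; rewrite -real_normK ?num_real// -[leRHS](expr1n _ 2).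
  by rewrite ler_pXn2r ?nnegrE// Z1.
Qed.

(** For counting common inlier neighbours.  The terms have variance at most
   [(p * q) ^+ 2]; this keeps the bound useful for deviations [t] that are a
   constant fraction of the mean [size s * (p * q) ^+ 2], which may be much
   smaller than the square root of [size s]. *)
Lemma inlier_pair_tail (K : eqType) (s : seq K) (e1 e2 : K -> upper_pair n)
    (la t : R) :
  0 <= p * q <= 1 ->
  uniq s -> {in s &, injective e1} -> {in s &, injective e2} ->
  (forall k l, k \in s -> l \in s -> e1 k != e2 l) ->
  0 <= la <= 2^-1 ->
  measurable [set w | t <= \sum_(k <- s) ((p * q) ^+ 2 -
       (inlier (edge_st (e1 k) w))%:R * (inlier (edge_st (e2 k) w))%:R)] /\
  (P [set w | t <= \sum_(k <- s) ((p * q) ^+ 2 -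
       (inlier (edge_st (e1 k) w))%:R * (inlier (edge_st (e2 k) w))%:R)]%R
   <= (expR (2 * la ^+ 2 * (size s)%:R * (p * q) ^+ 2 - la * t))%:E)%E.
Proof.
move=> /andP[pq0 pq1] us inj1 inj2 dis hla.
pose a e w : R := (inlier (edge_st e w))%:R.
pose phi (e : upper_pair n) s : R := (inlier s)%:R.
pose g := rcm_fun phi (fun _ _ => 1).
have b1 : forall e : upper_pair n, bounded_mfun ((fun _ _ => 1) e : borel_mx R d -> R).
  by move=> _; exact: bounded_mfun_cst.
have bg i : bounded_mfun (g i) by exact: rcm_fun_bounded.
have lg i r : rcm_events i [set w | r <= g i w] by exact: rcm_fun_levels.
have ba e : bounded_mfun (a e) by exact: (bg (inl e)).
have a01 e w : a e w = 0 \/ a e w = 1 by rewrite /a; case: (inlier _); [right|left].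
have bZ k : bounded_mfun (fun w => (p * q) ^+ 2 - a (e1 k) w * a (e2 k) w).
  apply: bounded_mfunB; first exact: bounded_mfun_cst.
  by apply: bounded_mfunM.
have uf : uniq (flatten
    [seq [:: inl (e1 k); inl (e2 k) : upper_pair n + upper_pair n] | k <- s]).
  apply: uniq_flatten_pairs => //.
  - by move=> k l ks ls [] /inj1; exact.
  - by move=> k l ks ls [] /inj2; exact.
have Eaa k : k \in s -> 'E (fun w => a (e1 k) w * a (e2 k) w) = (p * q) ^+ 2.
  move=> ks.
  have ne : inl (e1 k) != inl (e2 k) :> upper_pair n + upper_pair n.
    by apply/eqP => -[] /eqP; rewrite (negbTE (dis k k ks ks)).
  have := mean_prod_indep rcm_events_indep rcm_events_measurable bg lg
    (s := [:: inl (e1 k); inl (e2 k)]).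
  rewrite /= inE ne => /(_ erefl).
  rewrite big_cons big_seq1 /= expr2 -{1}(mean_inlier (e1 k)) -(mean_inlier (e2 k)) => <-.
  by congr Rintegral; apply/funext => w; rewrite big_cons big_seq1.
have pq2 : 0 <= (p * q) ^+ 2 <= 1 by rewrite sqr_ge0/= exprn_ile1.
change (measurable [set w | t <= \sum_(k <- s) ((p * q) ^+ 2 - a (e1 k) w * a (e2 k) w)] /\
  (P [set w | t <= \sum_(k <- s) ((p * q) ^+ 2 - a (e1 k) w * a (e2 k) w)]%R
   <= (expR (2 * la ^+ 2 * (size s)%:R * (p * q) ^+ 2 - la * t))%:E)%E).
apply: (block_tail (F := rcm_events) (g := g) (i1 := fun k => inl (e1 k))
  (i2 := fun k => inl (e2 k)) (a := fun=> expR (la * (p * q) ^+ 2))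
  (b := fun=> expR (la * (p * q) ^+ 2) * (expR (- la) - 1))) => //.
- exact: rcm_events_indep.
- exact: rcm_events_measurable.
- move=> k w; rewrite mulrBr expRD.
  change (expR (la * (p * q) ^+ 2) * expR (- (la * (a (e1 k) w * a (e2 k) w))) =
   expR (la * (p * q) ^+ 2) + expR (la * (p * q) ^+ 2) * (expR (- la) - 1) *
     (a (e1 k) w * a (e2 k) w)).
  have [->|->] := a01 (e1 k) w; first by rewrite !mul0r !mulr0 oppr0 expR0; ring.
  have [->|->] := a01 (e2 k) w; first by rewrite !mulr0 oppr0 expR0; ring.
  by rewrite !mulr1; ring.
- move=> k w _; rewrite ler_norml; move: pq2 => /andP[h0 h1].
  have [->|->] := a01 (e1 k) w; have [->|->] := a01 (e2 k) w;
    rewrite ?mulr0 ?mul0r ?mulr1; apply/andP; split; lra.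
- move=> k ks; rewrite (meanB P (bounded_mfun_cst _) (bounded_mfunM (ba (e1 k)) (ba (e2 k)))).
  by rewrite mean_cst Eaa// subrr.
- move=> k ks.
  have baa := bounded_mfunM (ba (e1 k)) (ba (e2 k)).
  rewrite (_ : (fun w => _) = (fun w => (p * q) ^+ 4 +
     (1 - 2 * (p * q) ^+ 2) * (a (e1 k) w * a (e2 k) w))); last first.
    apply/funext => w.
    by have [->|->] := a01 (e1 k) w; have [->|->] := a01 (e2 k) w; ring.
  rewrite (meanD P (bounded_mfun_cst _) (bounded_mfunZ _ baa)) (meanZ P _ baa) mean_cst Eaa//.
  have -> : (p * q) ^+ 4 + (1 - 2 * (p * q) ^+ 2) * (p * q) ^+ 2 =
      (p * q) ^+ 2 - ((p * q) ^+ 2) ^+ 2 by ring.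
  by rewrite gerBl sqr_ge0.
Qed.

End Model.

(** * The gap of the objective under deterministic hypotheses *)

Section ObjectiveGap.
Context {R : realType} {d n : nat} {p q : R} {disp : measure_display}
  {Omega : measurableType disp} {P : probability Omega R}.
Variables (M : rcm d n p q P) (Xs : 'I_n -> 'M[R]_d) (w : Omega).
Hypothesis hXs : SOn R n d Xs.

Definition inlier_pair (i j : 'I_n) := inlier (sym_status M w i j).
Definition outlier_pair (i j : 'I_n) := outlier (sym_status M w i j).

(** The observation seen in the frames of the ground truth: the identity for
   an inlier. *)
Definition frame_obs (i j : 'I_n) : 'M[R]_d := (Xs i)^T *m Y M Xs w i j *m Xs j.

Lemma sym_statusC i j : sym_status M w i j = sym_status M w j i.
Proof. by rewrite /sym_status; case: ltngtP. Qed.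

Lemma Y_tr i j : Y M Xs w j i = (Y M Xs w i j)^T.
Proof. by rewrite /Y; case: ltngtP => _; rewrite ?trmxK ?trmx0. Qed.

Lemma frame_obs_tr i j : frame_obs j i = (frame_obs i j)^T.
Proof. by rewrite /frame_obs !trmx_mul trmxK Y_tr mulmxA. Qed.

Lemma inlier_obs i j : inlier_pair i j -> Y M Xs w i j = Xs i *m (Xs j)^T.
Proof.
rewrite /inlier_pair /sym_status /Y /Y_upper.
case: ltngtP => // _; case: (rcm_status _ _ _ _) => // _.
by rewrite trmx_mul trmxK.
Qed.

Lemma objectiveE X : objective M Xs w X = \sum_i \sum_j
  ((inlier_pair i j)%:R + (outlier_pair i j)%:R) * frob (X i *m (X j)^T - Y M Xs w i j).
Proof.
rewrite /objective big_mkcond pair_big /=; apply: eq_bigr => -[i j] _ /=.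
rewrite /observed /inlier_pair /outlier_pair.
by case: (sym_status _ _ _ _) => /=; rewrite ?addr0 ?add0r ?mul1r ?mul0r.
Qed.

(** The constants: the inliers give [199/900 n P] times dist_1 and the outliers
   take away at most [1/32 + 1/25], for the skew row sums and for the quadratic
   terms; the remainder exceeds [1/8]. *)
Lemma objective_gap (X : 'I_n -> 'M[R]_d) (Q : 'M[R]_d) :
  0 < p < 1 -> 0 < q < 1 -> (0 < d)%N ->
  (forall i k, i != k ->
     n%:R * (p * q) ^+ 2 / 2 <= \sum_j ((inlier_pair i j)%:R * (inlier_pair k j)%:R)) ->
  (forall i, \sum_j (inlier_pair i j)%:R <= 9 / 8 * (n%:R * (p * q))) ->
  (forall i, \sum_j (outlier_pair i j)%:R <= 2 * (n%:R * q)) ->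
  (forall i x y, \sum_j (outlier_pair i j)%:R * skew_dir (frame_obs i j) x y
     <= n%:R * (p * q) / (64 * d%:R)) ->
  SOn R n d X -> argmin_SO X Xs Q -> distoo X Xs Q <= 100^-1 * p ->
  n%:R * p * q / 8 * dist1 X Xs Q <= objective M Xs w X - objective M Xs w Xs.
Proof.
move=> /andP[p0 p1] /andP[q0 q1] d0 hN hDg hDo hsk hX hQ hoo.
have [[Q1 _] _] := hQ.
pose U i : 'M[R]_d := (Xs i)^T *m X i *m Q^T.
have oXs i : (Xs i)^T *m Xs i = 1%:M by have [] := hXs i.
have oXs' i : Xs i *m (Xs i)^T = 1%:M by exact: mulmx1C.
have oU i : (U i)^T *m U i = 1%:M.
  have [hx _] := hX i.
  rewrite /U !trmx_mul !trmxK !mulmxA -(mulmxA (Q *m _)) oXs' mulmx1.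
  by rewrite -(mulmxA Q) hx mulmx1 (mulmx1C Q1).
have XU i : X i = Xs i *m U i *m Q.
  by rewrite /U !mulmxA oXs' mul1mx -mulmxA Q1 mulmx1.
have Sym : (\sum_i U i)^T = \sum_i U i by exact: argmin_symmetric hXs hQ.
have distE i : frob (X i - Xs i *m Q) = frob (U i - 1%:M).
  rewrite [in LHS]XU -mulmxBl frob_orthr// -[X in _ - X]mulmx1 -mulmxBr.
  by rewrite frob_orthl.
have hde i : frob (U i - 1%:M) <= 100^-1 * p.
  by rewrite -distE (le_trans _ hoo)// (le_bigmax _ (fun i => frob (X i - Xs i *m Q))).
have XX i j : X i *m (X j)^T = Xs i *m (U i *m (U j)^T) *m (Xs j)^T.
  rewrite [in LHS]XU [in LHS](XU j) !trmx_mul !mulmxA.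
  by rewrite -(mulmxA _ Q) (mulmx1C Q1) mulmx1.
have frame (A B : 'M[R]_d) i j : frob (Xs i *m A *m (Xs j)^T - B) =
    frob (A - (Xs i)^T *m B *m Xs j).
  have -> : Xs i *m A *m (Xs j)^T - B =
      Xs i *m (A - (Xs i)^T *m B *m Xs j) *m (Xs j)^T.
    rewrite mulmxBr mulmxBl !mulmxA oXs' mul1mx -(mulmxA B) oXs' mulmx1.
    by [].
  rewrite frob_orthr; last by rewrite trmxK.
  by rewrite frob_orthl.
pose G i j : 'M[R]_d := (frob (1%:M - frame_obs i j))^-1 *: (1%:M - frame_obs i j).
have GT i j : G j i = (G i j)^T.
  rewrite /G linearZ /= frame_obs_tr; congr (_^-1 *: _).
    by rewrite -[LHS]frob_tr linearB /= trmxK trmx1.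
  by rewrite linearB /= trmx1.
have Gskew i j x y : G i j x y - G i j y x = 2 * skew_dir (frame_obs i j) x y.
  rewrite /G /skew_dir.
  set A := 1%:M - frame_obs i j.
  have ZE (b : R) (B : 'M[R]_d) u v : (b *: B) u v = b * B u v by rewrite mxE.
  by rewrite !ZE invfM; move: (frob A)^-1 => b; field.
set T := dist1 X Xs Q.
have TE : T = \sum_i frob (U i - 1%:M) by apply: eq_bigr => i _; exact: distE.
have T0 : 0 <= T by apply: sumr_ge0 => i _.
have n0 : 0 <= n%:R :> R by rewrite ler0n.
have pq0 : 0 < p * q by rewrite mulr_gt0.
have nP0 : 0 <= n%:R * (p * q) by rewrite mulr_ge0// ltW.
have asym : symmetric inlier_pair by move=> i j; rewrite /inlier_pair sym_statusC.
have osym : symmetric outlier_pair by move=> i j; rewrite /outlier_pair sym_statusC.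
have hI := inlier_sum_ge oU Sym hde asym _ hN hDg.
have hO := @outlier_sum_ge R n d U outlier_pair G (2 * (n%:R * q))
  (2 * (n%:R * (p * q) / (64 * d%:R))) (100^-1 * p) oU hde _ osym GT _ hDo _ _.
set SI := \sum_i \sum_j (inlier_pair i j)%:R * frob (U i - U j) in hI.
set SO' := \sum_i \sum_j
  (outlier_pair i j)%:R * frobdot (U i *m (U j)^T - 1%:M) (G i j) in hO.
have gap : SI + SO' <= objective M Xs w X - objective M Xs w Xs.
  rewrite !objectiveE -big_split -sumrB; apply: ler_sum => i _ /=.
  rewrite -big_split -sumrB; apply: ler_sum => j _ /=.
  have e1 : frob (Xs i *m (Xs j)^T - Y M Xs w i j) = frob (1%:M - frame_obs i j).
    by rewrite -[Xs i in LHS]mulmx1 frame.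
  have e2 : frob (X i *m (X j)^T - Y M Xs w i j) = frob (U i *m (U j)^T - frame_obs i j).
    by rewrite XX frame.
  rewrite -mulrBr mulrDl lerD//.
    have [h|_] := boolP (inlier_pair i j); last by rewrite !mul0r.
    rewrite e1 e2 /frame_obs inlier_obs// !mulmxA oXs mul1mx oXs subrr frob0 subr0.
    have -> : U i *m (U j)^T - 1%:M = (U i - U j) *m (U j)^T.
      by rewrite mulmxBl (mulmx1C (oU j)).
    by rewrite frob_orthr// trmxK (mulmx1C (oU j)).
  rewrite ler_wpM2l// e1 e2.
  have := frob_subgradient (1%:M - frame_obs i j) (U i *m (U j)^T - frame_obs i j).
  by rewrite opprB addrA subrK.
apply: le_trans gap.
have dd : d%:R != 0 :> R by rewrite pnatr_eq0 -lt0n.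
have hI2 : n%:R * (p * q) * (199 / 900) * T <= SI.
  have hI3 : n%:R * (p * q) ^+ 2 / 2 * (n%:R * (1 - 100^-1 * p / 2)) * T <=
     2 * (9 / 8 * (n%:R * (p * q))) * SI.
    by rewrite TE; apply: hI; rewrite divr_ge0// mulr_ge0// sqr_ge0.
  have [nz|nz] := eqVneq (n%:R : R) 0.
    rewrite nz !mul0r /SI; apply: sumr_ge0 => i _; apply: sumr_ge0 => j _.
    by rewrite mulr_ge0.
  have np : 0 < n%:R * (p * q) by rewrite mulr_gt0// lt0r nz.
  rewrite -(ler_pM2l np).
  have h5 : 0 <= (n%:R * (p * q)) ^+ 2 * T * (1 - p).
    apply: mulr_ge0; last by rewrite subr_ge0 ltW.
    by apply: mulr_ge0 => //; exact: sqr_ge0.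
  lra.
have hO2 : - ((d%:R * (2 * (n%:R * (p * q) / (64 * d%:R))) +
    2 * (100^-1 * p) * (2 * (n%:R * q))) * T) <= SO'.
  rewrite TE; apply: hO.
  - by rewrite mulr_ge0// ltW.
  - by move=> i j; exact: frob_normalize_le1.
  - by rewrite mulr_ge0// divr_ge0// mulr_ge0.
  - move=> i x y.
    rewrite (eq_bigr (fun j => 2 * ((outlier_pair i j)%:R * skew_dir (frame_obs i j) x y))).
      by rewrite -mulr_sumr ler_wpM2l// hsk.
    by move=> j _; rewrite Gskew; ring.
have e3 : d%:R * (2 * (n%:R * (p * q) / (64 * d%:R))) = n%:R * (p * q) / 32 :> R by field.
rewrite e3 in hO2.
have h6 : 0 <= n%:R * (p * q) * T by rewrite mulr_ge0.
lra.
Qed.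

End ObjectiveGap.

(** * Bad events *)

Lemma union_bound {R : realType} {disp : measure_display}
    {T : measurableType disp} (P : probability T R) (I : finType)
    (A : I -> set T) (e : R) :
  (forall i, measurable (A i) /\ (P (A i) <= e%:E)%E) ->
  exists E : set T, [/\ measurable E, ((1 - #|I|%:R * e)%:E <= P E)%E &
    forall w, E w -> forall i, ~ A i w].
Proof.
move=> hA.
have mU : measurable (\bigcup_i A i).
  by apply: fin_bigcup_measurable => // i _; have [] := hA i.
have bA i : bounded_mfun (\1_(A i) : T -> R).
  by apply: bounded_mfun_indic; have [] := hA i.
exists (~` \bigcup_i A i); split.
- exact: measurableC.
- have h : Rintegral P setT (\1_(\bigcup_i A i) : T -> R) <= #|I|%:R * e.
    apply: (@le_trans _ _ (Rintegral P setT (fun x => \sum_i \1_(A i) x))).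
      apply: mean_le; [exact: bounded_mfun_indic|exact: bounded_mfun_sum|].
      move=> x; rewrite [leLHS]indicE; case: (boolP (_ \in _)) => [|_]; last first.
        by apply: sumr_ge0 => i _; rewrite indicE.
      rewrite inE => -[i _ Ai]; rewrite (bigD1 i)//= indicE mem_set// lerDl.
      by apply: sumr_ge0 => j _; rewrite indicE.
    rewrite mean_sum// -sum1_card natr_sum mulr_suml.
    apply: ler_sum => i _; rewrite mul1r -lee_fin mean_indic; last by have [] := hA i.
    by have [] := hA i.
  by rewrite probability_setC// -mean_indic// -EFinB lee_fin lerB.
- by move=> w hw i hi; apply: hw; exists i.
Qed.

Section Edges.
Context {n : nat}.
Hypothesis n2 : (2 <= n)%N.

(** A dummy that makes [edge] total, as index maps have to be. *)
Definition edge0 : upper_pair n :=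
  exist _ (Ordinal (ltnW n2), Ordinal n2) (ltnSn 0).

Definition edge (i j : 'I_n) : upper_pair n :=
  insubd edge0 (if (i < j)%N then (i, j) else (j, i)).

Lemma val_edge i j : i != j -> val (edge i j) = if (i < j)%N then (i, j) else (j, i).
Proof.
move=> ij; apply: insubdK; rewrite unfold_in /=.
by case: (ltngtP i j) => //= h; move: ij; rewrite (val_inj h) eqxx.
Qed.

Lemma edge_eq i j k l : i != j -> k != l -> edge i j = edge k l ->
  (i = k /\ j = l) \/ (i = l /\ j = k).
Proof.
move=> ij kl /(congr1 val); rewrite !val_edge//.
by case: ifP => _; case: ifP => _ [-> ->]; tauto.
Qed.

End Edges.

Section GoodEvent.
Context {R : realType} {d n : nat} {p q : R} {disp : measure_display}
  {Omega : measurableType disp} {P : probability Omega R}.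
Variables (M : rcm d n p q P) (Xs : 'I_n -> 'M[R]_d).
Hypotheses (hXs : SOn R n d Xs) (n2 : (2 <= n)%N).
Hypotheses (p01 : 0 < p < 1) (q01 : 0 < q < 1).
Local Notation "''E' f" := (Rintegral P setT f) (at level 10, f at level 9).
Local Notation edge := (edge n2).

Lemma sym_status_edge w i j : i != j -> sym_status M w i j = edge_st M (edge i j) w.
Proof.
move=> ij; rewrite /sym_status /edge_st (val_edge n2)//.
by case: ltngtP => // h; move: ij; rewrite (val_inj h) eqxx.
Qed.

(** For an edge [e] at vertex [i], the skew direction of its noise as seen from
   [i]; the noise has to be transposed when [i] is the larger end. *)
Definition edge_skew (i : 'I_n) x y (e : upper_pair n) (V : borel_mx R d) : R :=
  if (val e).1 == i then skew_dir ((Xs i)^T *m V *m Xs (val e).2) x y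
  else skew_dir ((Xs i)^T *m V^T *m Xs (val e).1) x y.

Let sandwich_measurable (A B : 'M[R]_d) (V : borel_mx R d -> 'M[R]_d) :
  mx_measurable V -> mx_measurable (fun x => A *m V x *m B).
Proof.
move=> mV; apply: (mx_measurable_mul (V := fun x => A *m V x) (W := fun=> B)).
  by apply: (mx_measurable_mul (V := fun=> A)) => //; exact: mx_measurable_cst.
exact: mx_measurable_cst.
Qed.

Lemma edge_skew_bounded i x y e : bounded_mfun (edge_skew i x y e).
Proof.
have mid : mx_measurable (id : borel_mx R d -> 'M[R]_d).
  by move=> u v; exact: measurable_mx_entry.
rewrite /edge_skew; case: ((val e).1 == i); apply: bounded_skew_dir; apply: sandwich_measurable => //.
exact: mx_measurable_tr.
Qed.

Lemma edge_skew_le1 i x y e V : `|edge_skew i x y e V| <= 1.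
Proof. by rewrite /edge_skew; case: ifP => _; exact: skew_dir_le1. Qed.

Lemma mean_edge_skew i x y e : 'E (fun w => edge_skew i x y e (edge_noise M e w)) = 0.
Proof.
rewrite mean_edge_noise; last exact: edge_skew_bounded.
have haar := rcm_haar M (valP e).
rewrite /edge_skew; case: ((val e).1 == i).
  by apply: (haar_skew_mean haar) => //; exact: SO_tr.
have -> : (fun V : borel_mx R d => skew_dir ((Xs i)^T *m V^T *m Xs (val e).1) x y) =
   (fun V : borel_mx R d => -1 * skew_dir ((Xs (val e).1)^T *m V *m Xs i) x y).
  apply/funext => V; rewrite mulN1r -skew_dir_tr !trmx_mul trmxK.
  by rewrite mulmxA.
rewrite meanZ; last first.
  by apply: bounded_skew_dir; apply: sandwich_measurable => u v; exact: measurable_mx_entry.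
by rewrite (haar_skew_mean haar) ?mulr0//; exact: SO_tr.
Qed.

Lemma skew_frame_obs w i j x y : i != j -> outlier_pair M w i j ->
  skew_dir (frame_obs M Xs w i j) x y =
  edge_skew i x y (edge i j) (edge_noise M (edge i j) w).
Proof.
move=> ij; rewrite /outlier_pair /frame_obs /edge_skew /edge_noise /sym_status /Y /Y_upper.
rewrite (val_edge n2)//; case: ltngtP => h /=.
- by rewrite eqxx; case: (rcm_status _ _ _ _).
- by rewrite eq_sym (negbTE ij); case: (rcm_status _ _ _ _).
- by move: ij; rewrite (val_inj h) eqxx.
Qed.

Let others (i : 'I_n) : seq 'I_n := enum [predC pred1 i].
Let others2 (i k : 'I_n) : seq 'I_n := enum [predC pred2 i k].

Let sum_others i (F : 'I_n -> R) : F i = 0 -> \sum_j F j = \sum_(j <- others i) F j.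
Proof.
move=> Fi; rewrite big_enum /= [RHS]big_mkcond; apply: eq_bigr => j _ /=.
by rewrite !inE; case: eqVneq => // ->.
Qed.

Let sum_others2 i k (F : 'I_n -> R) : F i = 0 -> F k = 0 ->
  \sum_j F j = \sum_(j <- others2 i k) F j.
Proof.
move=> Fi Fk; rewrite big_enum /= [RHS]big_mkcond; apply: eq_bigr => j _ /=.
rewrite !inE negb_or; case: eqVneq => [->//|_]; by case: eqVneq => [->//|_].
Qed.

Let size_others i : (size (others i)).+1 = n.
Proof. by rewrite -cardE cardC1 card_ord prednK// ltnW. Qed.

Let size_others2 i k : i != k -> (size (others2 i k)).+2 = n.
Proof.
by move=> ik; have := cardC (pred2 i k); rewrite card2 ik card_ord -cardE addSn add1n.
Qed.

Let sym_diag w i : sym_status M w i i = Missing.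
Proof. by rewrite /sym_status ltnn. Qed.

Lemma inlier_sum_edges w i : \sum_j (inlier_pair M w i j)%:R =
  \sum_(j <- others i) (inlier (edge_st M (edge i j) w))%:R :> R.
Proof.
rewrite (sum_others (i := i)); last by rewrite /inlier_pair sym_diag.
rewrite big_seq [RHS]big_seq; apply: eq_bigr => j; rewrite mem_enum inE => ji.
by rewrite /inlier_pair sym_status_edge// eq_sym.
Qed.

Lemma outlier_sum_edges w i (F : 'I_n -> R) : \sum_j (outlier_pair M w i j)%:R * F j =
  \sum_(j <- others i) (outlier (edge_st M (edge i j) w))%:R * F j.
Proof.
rewrite (sum_others (i := i)); last by rewrite /outlier_pair sym_diag mul0r.
rewrite big_seq [RHS]big_seq; apply: eq_bigr => j; rewrite mem_enum inE => ji.
by rewrite /outlier_pair sym_status_edge// eq_sym.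
Qed.

Let edge_inj i : {in others i &, injective (edge i)}.
Proof.
move=> j k; rewrite !mem_enum !inE => ji ki.
by move=> /edge_eq; rewrite eq_sym ji eq_sym ki => /(_ erefl erefl) [[]//|[<- ->]].
Qed.

(** In this order: two vertices have few common inlier neighbours, an inlier
   degree is large, an outlier degree is large, a row sum of skew directions is
   large.  A one-sided bound suffices for the last ones, since exchanging [x]
   and [y] changes the sign. *)
Definition bad_index : finType :=
  (('I_n * 'I_n) + ('I_n + ('I_n + 'I_n * ('I_d * 'I_d))))%type.

Definition bad_event (eps : R) (k : bad_index) : set Omega :=
  let t := eps * (n%:R * (p * q)) in
  match k with
  | inl (i, k) => if i == k then set0 else
      [set w | 4^-1 * ((size (others2 i k))%:R * (p * q) ^+ 2) <=
         \sum_(j <- others2 i k) ((p * q) ^+ 2 -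
          (inlier (edge_st M (edge i j) w))%:R * (inlier (edge_st M (edge k j) w))%:R)]
  | inr (inl i) => [set w | t <= \sum_(j <- others i)
          ((inlier (edge_st M (edge i j) w))%:R * 1 - p * q)]
  | inr (inr (inl i)) => [set w | t <= \sum_(j <- others i)
          ((outlier (edge_st M (edge i j) w))%:R * 1 - (1 - p) * q)]
  | inr (inr (inr (i, (x, y)))) => [set w | t <= \sum_(j <- others i)
          ((outlier (edge_st M (edge i j) w))%:R *
            edge_skew i x y (edge i j) (edge_noise M (edge i j) w) - 0)]
  end.

(** The exponent of the Chernoff bound is minimized by [la] of the order of the
   deviation divided by the total variance: [eps * P / 4] for the row sums, and
   a constant for the common neighbours. *)
Lemma bad_event_small (eps r : R) k : 0 < eps <= 1 ->
  r <= eps ^+ 2 * (n%:R * (p * q) ^+ 2) / 8 ->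
  (8 <= n)%N -> r <= n%:R * (p * q) ^+ 2 / 256 ->
  measurable (bad_event eps k) /\ (P (bad_event eps k) <= (expR (- r))%:E)%E.
Proof.
move=> /andP[e0 e1] hr1 n8 hr2.
have /andP[p0 p1] := p01; have /andP[q0 q1] := q01.
have pq0 : 0 < p * q by rewrite mulr_gt0.
have pq1 : p * q < 1 by rewrite mulr_ilt1 ?ltW.
have n0 : 0 < n%:R :> R by rewrite ltr0n ltnW.
have poq : 0 <= (1 - p) * q <= 1.
  have : p * q <= q by rewrite ler_piMl// ltW.
  by move=> h; apply/andP; split; lra.
pose la := eps * (p * q) / 4.
have hla : 0 <= la <= 2^-1.
  have : eps * (p * q) <= 1 by rewrite mulr_ile1// ltW.
  by have := mulr_gt0 e0 pq0; rewrite /la; lra.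
have b1 (e : upper_pair n) : bounded_mfun ((fun=> 1) : borel_mx R d -> R).
  exact: bounded_mfun_cst.
have hexp i : expR (2 * la ^+ 2 * (size (others i))%:R * 1
    - la * (eps * (n%:R * (p * q)))) <= expR (- r).
  rewrite ler_expR lerNr; apply: le_trans hr1 _.
  have sn : (size (others i))%:R <= n%:R :> R by rewrite ler_nat -[leqRHS](size_others i).
  have : la ^+ 2 * (size (others i))%:R <= la ^+ 2 * n%:R by rewrite ler_wpM2l// sqr_ge0.
  by rewrite /la; lra.
have uo i : uniq (others i) by exact: enum_uniq.
case: k => [[i k]|[i|[i|[i [x y]]]]] /=.
- have [_|ik] := eqVneq i k.
    by split => //; rewrite measure0 lee_fin ltW// expR_gt0.
  have l16 : (0 : R) <= (16^-1 : R) <= (2^-1 : R) by apply/andP; split; lra.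
  have pq01 : 0 <= p * q <= 1 by rewrite !ltW.
  have inj1 : {in others2 i k &, injective (edge i)}.
    move=> j l; rewrite !mem_enum !inE !negb_or => /andP[ji _] /andP[li _].
    by move=> /edge_eq; rewrite eq_sym ji eq_sym li => /(_ erefl erefl) [[]//|[<- ->]].
  have inj2 : {in others2 i k &, injective (edge k)}.
    move=> j l; rewrite !mem_enum !inE !negb_or => /andP[_ jk] /andP[_ lk].
    by move=> /edge_eq; rewrite eq_sym jk eq_sym lk => /(_ erefl erefl) [[]//|[<- ->]].
  have dis j l : j \in others2 i k -> l \in others2 i k -> edge i j != edge k l.
    rewrite !mem_enum !inE !negb_or => /andP[ji jk] /andP[li lk].
    apply/eqP => /edge_eq; rewrite eq_sym ji eq_sym lk => /(_ erefl erefl).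
    by case=> -[a b]; [move: ik; rewrite a eqxx|move: jk; rewrite b eqxx].
  have [m1 m2] := @inlier_pair_tail R d n p q disp Omega P M _
    (others2 i k) (edge i) (edge k)
    16^-1 (4^-1 * ((size (others2 i k))%:R * (p * q) ^+ 2))
    pq01 (enum_uniq _) inj1 inj2 dis l16.
  split=> //; apply: le_trans m2 _; rewrite lee_fin ler_expR lerNr.
  apply: le_trans hr2 _.
  have sz : (size (others2 i k))%:R + 2 = n%:R :> R.
    by rewrite -natrD addn2 size_others2.
  have n8' : 8 <= n%:R :> R by rewrite (ler_nat R 8).
  have : 0 <= (n%:R - 8) * (p * q) ^+ 2 by rewrite mulr_ge0 ?sqr_ge0// subr_ge0.
  have -> : (size (others2 i k))%:R = n%:R - 2 :> R by rewrite -sz addrK.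
  have := sqr_ge0 (p * q); lra.
- have [||m1 m2] := @edge_sum_tail R d n p q disp Omega P M _
    (others i) (edge i) inlier (fun _ _ => 1)
    (p * q) la (eps * (n%:R * (p * q))) (uo i) (@edge_inj i) b1 _ _ hla.
  + move=> j w _; rewrite ler_norml.
    by case: (inlier _); rewrite ?mul1r ?mul0r; apply/andP; split; lra.
  + by move=> j _; rewrite mean_inlier mean_cst mulr1.
  by split=> //; apply: le_trans m2 _; rewrite lee_fin.
- have [||m1 m2] := @edge_sum_tail R d n p q disp Omega P M _
    (others i) (edge i) outlier (fun _ _ => 1)
    ((1 - p) * q) la (eps * (n%:R * (p * q))) (uo i) (@edge_inj i) b1 _ _ hla.
  + move=> j w _; rewrite ler_norml; move: poq => /andP[h1 h2].
    by case: (outlier _); rewrite ?mul1r ?mul0r; apply/andP; split; lra.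
  + by move=> j _; rewrite mean_outlier mean_cst mulr1.
  by split=> //; apply: le_trans m2 _; rewrite lee_fin.
- have [||m1 m2] := @edge_sum_tail R d n p q disp Omega P M _
    (others i) (edge i) outlier (edge_skew i x y)
    0 la (eps * (n%:R * (p * q))) (uo i) (@edge_inj i) (edge_skew_bounded i x y) _ _ hla.
  + move=> j w _; rewrite subr0 normrM.
    by case: (outlier _); rewrite ?normr1 ?normr0 ?mul1r ?mul0r// edge_skew_le1.
  + by move=> j _; rewrite mean_edge_skew mulr0.
  by split=> //; apply: le_trans m2 _; rewrite lee_fin.
Qed.

Lemma good_event_gap w (X : 'I_n -> 'M[R]_d) (Q : 'M[R]_d) :
  (0 < d)%N -> (8 <= n)%N ->
  (forall k, ~ bad_event (64 * d%:R)^-1 k w) ->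
  SOn R n d X -> argmin_SO X Xs Q -> distoo X Xs Q <= 100^-1 * p ->
  n%:R * p * q / 8 * dist1 X Xs Q <= objective M Xs w X - objective M Xs w Xs.
Proof.
move=> d0 n8 good hX hQ hoo.
have /andP[p0 p1] := p01; have /andP[q0 q1] := q01.
have pq0 : 0 < p * q by rewrite mulr_gt0.
have n0 : 0 < n%:R :> R by rewrite ltr0n ltnW.
have n8' : 8 <= n%:R :> R by rewrite (ler_nat R 8).
have d1 : 1 <= d%:R :> R by rewrite (ler_nat R 1).
have e64 : (64 * d%:R)^-1 <= 64^-1 :> R by rewrite lef_pV2 ?posrE; lra.
have nP0 : 0 < n%:R * (p * q) by rewrite mulr_gt0.
have eP : (64 * d%:R)^-1 * (n%:R * (p * q)) <= 64^-1 * (n%:R * (p * q)).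
  by rewrite ler_pM2r.
have sz i : (size (others i))%:R + 1 = n%:R :> R.
  by rewrite natr1 size_others.
apply: objective_gap => //.
- move=> i k ik; have := good (inl (i, k)).
  rewrite /bad_event (negbTE ik) /= => /negP; rewrite -ltNge.
  rewrite sumrB big_const_seq count_predT iter_addr_0 -[_ *+ size _]mulr_natl.
  have sz2 : (size (others2 i k))%:R + 2 = n%:R :> R.
    by rewrite -natrD addn2 size_others2.
  have -> : (size (others2 i k))%:R = n%:R - 2 :> R by rewrite -sz2 addrK.
  have -> : \sum_j (inlier_pair M w i j)%:R * (inlier_pair M w k j)%:R =
     \sum_(j <- others2 i k) (inlier (edge_st M (edge i j) w))%:R *
       (inlier (edge_st M (edge k j) w))%:R :> R.
    rewrite (sum_others2 (i := i) (k := k)) /inlier_pair ?sym_diag ?mul0r ?mulr0//.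
    rewrite big_seq [RHS]big_seq; apply: eq_bigr => j.
    rewrite mem_enum !inE negb_or => /andP[ji jk].
    by rewrite !sym_status_edge// eq_sym.
  have := sqr_ge0 (p * q).
  have : 0 <= (n%:R - 8) * (p * q) ^+ 2 by rewrite mulr_ge0 ?sqr_ge0// subr_ge0.
  lra.
- move=> i; have := good (inr (inl i)) => /= /negP; rewrite -ltNge inlier_sum_edges.
  rewrite sumrB big_const_seq count_predT iter_addr_0 -[_ *+ size _]mulr_natl.
  under eq_bigr do rewrite mulr1.
  have -> : (size (others i))%:R = n%:R - 1 :> R by rewrite -(sz i) addrK.
  lra.
- move=> i; have := good (inr (inr (inl i))) => /= /negP; rewrite -ltNge.
  have -> : \sum_j (outlier_pair M w i j)%:R = \sum_j (outlier_pair M w i j)%:R * 1 :> R.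
    by apply: eq_bigr => j _; rewrite mulr1.
  rewrite outlier_sum_edges sumrB big_const_seq count_predT iter_addr_0 -[_ *+ size _]mulr_natl.
  have -> : (size (others i))%:R = n%:R - 1 :> R by rewrite -(sz i) addrK.
  have : 0 <= n%:R * (p * q) by exact: ltW.
  have : n%:R * (p * q) <= n%:R * q by rewrite ler_pM2l// ler_piMl// ltW.
  have : p * q <= q by rewrite ler_piMl// ltW.
  lra.
- move=> i x y; have := good (inr (inr (inr (i, (x, y))))) => /= /negP.
  rewrite -ltNge => /ltW h.
  rewrite outlier_sum_edges mulrC; apply: le_trans h.
  rewrite le_eqVlt; apply/orP; left; apply/eqP.
  rewrite big_seq [RHS]big_seq; apply: eq_bigr => j; rewrite mem_enum inE => ji.
  rewrite subr0; have ij : i != j by rewrite eq_sym.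
  have [h|_] := boolP (outlier _); last by rewrite !mul0r.
  by rewrite skew_frame_obs// /outlier_pair sym_status_edge.
Qed.

End GoodEvent.

Lemma ln_ge_half {R : realType} (n : nat) : (2 <= n)%N -> 2^-1 <= ln n%:R :> R.
Proof.
move=> n2; have n0 : 0 < n%:R :> R by rewrite ltr0n ltnW.
rewrite -ler_expR lnK ?posrE//.
have := expR_le_quadratic (lexx (2^-1 : R)).
have : 2 <= n%:R :> R by rewrite (ler_nat R 2).
lra.
Qed.

Theorem theorem3 (R : realType) (d : nat) (hd : (2 <= d)%N) :
  exists C C' c : R, [/\ 0 < C, 0 < C', 0 < c &
  forall (n : nat) (p q : R),
    (2 <= n)%N -> 0 < p < 1 -> 0 < q < 1 ->
    C * (ln n%:R / n%:R) <= p ^+ 2 * q ^+ 2 ->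
  forall (Xs : 'I_n -> 'M[R]_d), SOn R n d Xs ->
  forall (disp : measure_display) (Omega : measurableType disp)
    (P : probability Omega R) (M : rcm d n p q P),
  exists E : set Omega,
    [/\ measurable E,
        ((1 - C' / n%:R)%:E <= P E)%E &
        forall w, E w ->
        forall X : 'I_n -> 'M[R]_d, SOn R n d X ->
        forall Rs : 'M[R]_d, argmin_SO X Xs Rs ->
          distoo X Xs Rs <= c * p ->
          n%:R * p * q / 8 * dist1 X Xs Rs
            <= objective M Xs w X - objective M Xs w Xs]].
Proof.
have d1 : 1 <= d%:R :> R by rewrite (ler_nat R 1) ltnW.
have d0 : 0 < d%:R :> R by exact: lt_le_trans d1.
have dd : 0 <= d%:R ^+ 2 :> R by rewrite sqr_ge0.
have D0 : 64 <= (64 * d%:R) ^+ 2 :> R.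
  apply: (@le_trans _ _ (64 * d%:R)); first by lra.
  have h1 : 1 <= 64 * d%:R :> R by lra.
  have h0 : 0 <= 64 * d%:R :> R by lra.
  by rewrite expr2; exact: ler_peMl.
(* With deviation [n P / (64 d)] the Chernoff exponent is
   [n P^2 / (8 (64 d)^2)], and [C] makes it at least [3 ln n], so that each bad
   event has probability at most [n^-3]. *)
exists (24 * (64 * d%:R) ^+ 2), (3 + d%:R ^+ 2), 100^-1.
split => [|||n p q n2 p01 q01 hC Xs hXs disp Omega P M].
- by rewrite mulr_gt0//; lra.
- lra.
- by rewrite invr_gt0.
have /andP[p0 p1] := p01; have /andP[q0 q1] := q01.
have n0 : 0 < n%:R :> R by rewrite ltr0n ltnW.
set L := ln n%:R : R.
have L2 : 2^-1 <= L by exact: ln_ge_half.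
have hL : 24 * (64 * d%:R) ^+ 2 * L <= n%:R * (p * q) ^+ 2.
  move: hC; rewrite -/L mulrA ler_pdivrMr// -exprMn => hC.
  by rewrite [leRHS]mulrC.
have hdL : 64 * L <= (64 * d%:R) ^+ 2 * L by rewrite ler_pM2r//; lra.
(* The hypothesis can only hold for large [n], because [P <= 1]. *)
have n8 : (8 <= n)%N.
  have : n%:R * (p * q) ^+ 2 <= n%:R.
    rewrite ler_piMr ?(ltW n0)//.
    by rewrite exprn_ile1 ?mulr_ge0 ?mulr_ile1 ?(ltW p0) ?(ltW p1) ?(ltW q0) ?(ltW q1).
  by rewrite -(ler_nat R); lra.
have small k := @bad_event_small R d n p q disp Omega P M Xs hXs n2 p01 q01
  (64 * d%:R)^-1 (3 * L) k.
have [|E [mE PE hE]] := @union_bound R disp Omega P _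
  (bad_event M Xs n2 (64 * d%:R)^-1) (expR (- (3 * L))).
  move=> k; apply: small => //.
  - by rewrite invr_gt0 mulr_gt0//= invf_le1 ?mulr_gt0//; lra.
  - rewrite exprVn ler_pdivlMr// ler_pdivlMl; last by lra.
    by apply: le_trans hL; lra.
  - lra.
exists E; split => //.
  apply: le_trans PE; rewrite lee_fin lerB//.
  have -> : expR (- (3 * L)) = n%:R ^- 3 :> R.
    by rewrite expRN expRM_natl lnK ?posrE.
  rewrite /bad_index !card_sum !card_prod !card_ord.
  rewrite !natrD !natrM.
  rewrite ler_pdivlMr// -mulrA.
  have -> : n%:R ^- 3 * n%:R = n%:R ^- 2 :> R by field; rewrite gt_eqF.
  rewrite ler_pdivrMr ?exprn_gt0//.
  have : 0 <= (n%:R - 1) * n%:R * (2 + d%:R ^+ 2) :> R.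
    have h1 : 0 <= n%:R - 1 :> R by rewrite subr_ge0 (ler_nat R 1) ltnW.
    apply: mulr_ge0; first by rewrite mulr_ge0// ltW.
    by rewrite addr_ge0.
  lra.
move=> w Ew X hX Rs hRs hoo.
apply: (@good_event_gap R d n p q disp Omega P M Xs hXs n2 p01 q01 w X Rs) => //.
  exact: ltnW.
exact: hE.
Qed.
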